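(* Let $\lambda:\mathbb{Z}_+\to[0,\infty)$ and $\mu_1,\mu_2>0$, and for each $n\ge 0$ let $Z_n\sim\operatorname{geom}_n(\mu_1/\mu_2)$. The family $\mathcal{V}=\{V_r: r>0\}$ contains a Lyapunov function for the transition rates $q$ of the system $S(\lambda,\mu_1,\mu_2)$ if and only if $$\limsup_{n\to\infty}\, \mathrm{E}\,\lambda(Z_n) < \min(\mu_1,\mu_2).\qquad ( * )$$ In particular, if $\lambda(0)>0$, then $( * )$ is sufficient for the stability of $S(\lambda,\mu_1,\mu_2)$.
   Context: $\mathbb{Z}_+=\{0,1,2,\dots\}$ and $e_1,e_2$ are the unit vectors of $\mathbb{Z}_+^2$. The system $S(\lambda,\mu_1,\mu_2)$ (for a nonnegative function $\lambda$ on $\mathbb{Z}_+$ and $\mu_1,\mu_2>0$) is the set of transition rates $q(x,y)$, $x\ne y$, $x,y\in\mathbb{Z}_+^2$, given by $q(x,x+e_1)=\lambda(x_2)$; $q(x,x-e_1+e_2)=\mu_1$ if $x_1\ge1$; $q(x,x-e_2)=\mu_2$ if $x_2\ge 1$; and $q(x,y)=0$ otherwise. Set $q(x)=\sum_{y\ne x}q(x,y)<\infty$ and $q(x,x)=-q(x)$. These rates define, by the minimal construction, a unique continuous-time Markov process $X=(X_1,X_2)$ on $\mathbb{Z}_+^2\cup\{\kappa\}$, where $\kappa$ is an extra state entered at the explosion time. The system is called stable if this Markov process is ergodic, that is, irreducible and positive recurrent (on $\mathbb{Z}_+^2$). For $z\ge0$, $Z_n\sim\operatorname{geom}_n(z)$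 means that $Z_n$ takes values in $\{0,1,\dots,n\}$ with $\mathrm{P}(Z_n=j)=z^j/\sum_{i=0}^n z^i$. For $r>0$ define $V_r:\mathbb{Z}_+^2\to\mathbb{R}$ by $$V_r(x)=x_1+\sum_{j=0}^{x_2-1}\sum_{k=0}^{j}\bigl(1-(\lambda(k)+r)/\mu_1\bigr)\,(\mu_1/\mu_2)^{k-j}.$$ The mean drift of a function $V$ on a countable set $S$ with respect to $q$ is $\Delta V(x)=\sum_{y\ne x}(V(y)-V(x))\,q(x,y)$, when the sum converges. A map $V:S\to\mathbb{R}$ is a Lyapunov function for $q$ if: (F1) $\sum_{y\ne x}|V(y)-V(x)|\,q(x,y)<\infty$ for all $x\in S$; (F2) $\lim_{x\to\infty}V(x)=\infty$, meaning that $\{x: V(x)\le M\}$ is finite for every $M\in\mathbb{R}$; (F3) there is a finite set $S_0\subset S$ with $\sup_{x\in S\setminus S_0}\Delta V(x)<0$. Here $S=\mathbb{Z}_+^2$. *)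

(* Defs.v *)
(* MathComp / MathComp-Analysis. *)
From HB Require Import structures.
From mathcomp Require Export all_boot all_order all_algebra.
From mathcomp Require Export all_classical all_reals all_analysis.
From mathcomp Require Export measurable_realfun.

Set Implicit Arguments.
Unset Strict Implicit.
Unset Printing Implicit Defensive.

Import Order.TTheory GRing.Theory Num.Theory.
Import numFieldNormedType.Exports.

Local Open Scope classical_set_scope.
Local Open Scope ring_scope.

(* Transition rates on a countable set S are given as q : S -> S -> R; only
   the off-diagonal values q x y, x != y, are ever used below, so the
   convention q(x, x) = - q(x) plays no role. *)

Definition exit_rate (R : realType) (S : countType) (q : S -> S -> R) (x : S)
    : R :=
  fine (\esum_(y in [set~ x]) (q x y)%:E).

(* Jump chain of the minimal construction; a state without outgoing rates is
   absorbing. *)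
Definition jump_prob (R : realType) (S : countType) (q : S -> S -> R)
    (x y : S) : R :=
  if exit_rate q x == 0 then (x == y)%:R
  else if x == y then 0 else q x y / exit_rate q x.

(* (Y, H) are the successive states and holding times of the minimal process
   with rates q started at x: Y is a Markov chain with transition matrix
   jump_prob q, and given Y the H i are independent and exponential with
   parameter exit_rate q (Y i).  Holding times are [0, +oo]-valued: the law
   below gives H i = +oo almost surely in absorbing states. *)
Record minimal_construction (R : realType) (S : countType) (q : S -> S -> R)
    (x : S) (d : measure_display) (T : measurableType d) (P : probability T R)
    (Y : nat -> T -> S) (H : nat -> T -> \bar R) : Prop := MinimalConstruction {
  mc_measurable_jump : forall n y, measurable (Y n @^-1` [set y]);
  mc_measurable_hold : forall n, measurable_fun [set: T] (H n);
  mc_hold_ge0 : forall n w, (0 <= H n w)%E;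
  mc_law : forall (n : nat) (y : nat -> S) (t : nat -> R),
    (forall i, 0 <= t i) ->
    P [set w | forall i, (i <= n)%N -> Y i w = y i /\ ((t i)%:E < H i w)%E] =
    ((y 0%N == x)%:R
     * (\prod_(i < n) jump_prob q (y i) (y i.+1))
     * (\prod_(i < n.+1) expR (- (exit_rate q (y i) * t i))))%:E }.

Definition jump_time (R : realType) (T : Type) (H : nat -> T -> \bar R)
    (n : nat) (w : T) : \bar R :=
  (\sum_(i < n) H i w)%E.

(* The process at time t; None is the extra state entered at the explosion
   time sup_n jump_time H n. *)
Definition process (R : realType) (S : countType) (T : Type)
    (Y : nat -> T -> S) (H : nat -> T -> \bar R) (t : R) (w : T) : option S :=
  xget None [set Some (Y n w) | n in
    [set n | (jump_time H n w <= t%:E < jump_time H n.+1 w)%E]].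

Definition return_time (R : realType) (S : countType) (T : Type)
    (Y : nat -> T -> S) (H : nat -> T -> \bar R) (x : S) (w : T) : \bar R :=
  ereal_inf [set t%:E | t in
    [set t : R | (jump_time H 1 w <= t%:E)%E /\ process Y H t w = Some x]].

(* The law of (Y, H) is determined by q and the initial state, so the
   properties below do not depend on the chosen realization. *)
Definition irreducible (R : realType) (S : countType) (q : S -> S -> R)
    : Prop :=
  forall (x y : S) (d : measure_display) (T : measurableType d)
    (P : probability T R) (Y : nat -> T -> S) (H : nat -> T -> \bar R),
    minimal_construction q x P Y H ->
    exists2 t : R, 0 <= t & (0 < P [set w | process Y H t w = Some y])%E.

Definition positive_recurrent (R : realType) (S : countType)
    (q : S -> S -> R) : Prop :=
  forall (x : S) (d : measure_display) (T : measurableType d)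
    (P : probability T R) (Y : nat -> T -> S) (H : nat -> T -> \bar R),
    minimal_construction q x P Y H ->
    exit_rate q x = 0 \/ (\int[P]_w return_time Y H x w < +oo)%E.

Definition ergodic (R : realType) (S : countType) (q : S -> S -> R) : Prop :=
  irreducible q /\ positive_recurrent q.

(* The sum of (V y - V x) q(x, y) over y != x, as the difference of the sums
   of its positive and negative parts; it is meant for V satisfying
   lyapunov_F1, where both are finite. *)
Definition drift (R : realType) (S : countType) (q : S -> S -> R)
    (V : S -> R) (x : S) : \bar R :=
  ((\esum_(y in [set~ x]) (Num.max ((V y - V x) * q x y) 0)%:E)
   - (\esum_(y in [set~ x]) (Num.max (- ((V y - V x) * q x y)) 0)%:E))%E.

Record lyapunov (R : realType) (S : countType) (q : S -> S -> R)
    (V : S -> R) : Prop := Lyapunov {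
  lyapunov_F1 : forall x,
    (\esum_(y in [set~ x]) (`|V y - V x| * q x y)%:E < +oo)%E;
  lyapunov_F2 : forall M : R, finite_set [set x | V x <= M];
  lyapunov_F3 : exists2 S0 : set S, finite_set S0 &
    (ereal_sup [set drift q V x | x in ~` S0] < 0)%E }.

Definition system_rate (R : realType) (lam : nat -> R) (mu1 mu2 : R)
    (x y : nat * nat) : R :=
  if y == (x.1.+1, x.2) then lam x.2
  else if (1 <= x.1)%N && (y == (x.1.-1, x.2.+1)) then mu1
  else if (1 <= x.2)%N && (y == (x.1, x.2.-1)) then mu2
  else 0.

Definition stable (R : realType) (lam : nat -> R) (mu1 mu2 : R) : Prop :=
  ergodic (system_rate lam mu1 mu2).

(* Z ~ geom_n(z) *)
Definition geom_law (R : realType) (n : nat) (z : R) (d : measure_display)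
    (T : measurableType d) (P : probability T R) (Z : {RV P >-> nat}) : Prop :=
  forall j : nat, distribution P Z [set j] =
    (if (j <= n)%N then z ^+ j / \sum_(i < n.+1) z ^+ i else 0)%:E.

Definition V_fun (R : realType) (lam : nat -> R) (mu1 mu2 r : R)
    (x : nat * nat) : R :=
  x.1%:R + \sum_(0 <= j < x.2) \sum_(0 <= k < j.+1)
    (1 - (lam k + r) / mu1) * (mu1 / mu2) ^ (k%:Z - j%:Z).

(* Main.v *)
Require Import Defs.
From mathcomp Require Import ring lra zify.
Import Order.TTheory GRing.Theory Num.Theory.
Import numFieldNormedType.Exports.
Local Open Scope classical_set_scope.
Local Open Scope ring_scope.

(** The function [V_fun] has slope [1] in the first coordinate and slopes
    [slope r n] in the second, and the slopes solve the recursion [slopeS], which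
    makes the drift equal to [- r] at every state with a nonempty first queue
    ([drift_interior]). At a state [(0, n)] the drift is
    [mu1 - r - mu1 * slope r n] ([drift_boundary]), so that everything depends on
    the slopes for large [n]. Now
    [mu1 * slope r n = geom_weight n * (mu1 - E lam (Z_n) - r)]
    ([slope_geom_mean]), where [geom_weight n] tends to infinity if [mu1 <= mu2]
    and to [mu1 / (mu1 - mu2)] otherwise. Hence if the means stay below
    [min mu1 mu2] by a fixed gap, then for [r] small the slopes are eventually at
    least [1], which gives negative drift on the boundary and coercivity at the
    same time ([slope_eventually_ge1], [slope_lyapunov]); conversely a negative
    drift on the boundary forces such a gap ([lyapunov_slope],
    [geom_mean_eventually_le]).

    Stability follows from Foster's criterion, proved here for all rates with
    finitely many successors per state. Fix a state [x] and kill the jump chain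
    when it enters [x]. Communication makes the killed chain die with a
    probability bounded below from each point of a finite set within a fixed
    number of steps, so it visits a finite set boundedly often on average
    ([occupation_bounded]). Summing the Lyapunov inequality along the killed chain
    then bounds the expected sum of the mean holding times before the return
    ([drift_bounds]), and coercivity makes the survival probability tend to zero
    ([survival_cvg0]). All of this concerns iterates of a kernel with finite sums.

    The passage to the process uses that, up to a null event, the first [n] jumps
    follow one of finitely many paths. The return time is at most the sum of the
    holding times before the first return of the jump chain
    ([return_time_excursion]), and each holding time is bounded by a discrete
    layer-cake sum over events of the form prescribed by the law
    ([le_sum_tail], [path_hold_integral]). Irreducibility follows by letting the
    chain run along a path and observing the process at a rational time
    ([process_visits]). *)

(** * Finite-range kernels *)

Section Transfer.
Context {R : realType} {S : countType}.
Implicit Types (p : S -> S -> R) (nb : S -> seq S) (f g : S -> R) (x y : S).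

Definition transfer p nb f x : R := \sum_(y <- nb x) p x y * f y.

(** Expected sum of [f] over the first [n] steps of the chain; for an indicator
    function this is the expected number of visits. *)
Definition occupation p nb n f x : R :=
  \sum_(i < n) iter i (transfer p nb) f x.

Definition charac (F : seq S) x : R := (x \in F)%:R.

Context (p : S -> S -> R) (nb : S -> seq S).
Hypothesis p_ge0 : forall x y, 0 <= p x y.
Let K := transfer p nb.

Lemma le_transfer f g : (forall x, f x <= g x) -> forall x, K f x <= K g x.
Proof. by move=> fg x; apply: ler_sum => y _; exact: ler_wpM2l. Qed.

Lemma le_iter_transfer n f g :
  (forall x, f x <= g x) -> forall x, iter n K f x <= iter n K g x.
Proof. by move=> fg; elim: n => //= n IH; exact: le_transfer. Qed.

Lemma iter_transfer_ge0 n f :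
  (forall x, 0 <= f x) -> forall x, 0 <= iter n K f x.
Proof.
move=> f0; elim: n => //= n IH x.
by apply: sumr_ge0 => y _; exact: mulr_ge0.
Qed.

Lemma transfer_comb (a b : R) f g x :
  K (fun y => a * f y + b * g y) x = a * K f x + b * K g x.
Proof.
rewrite /K /transfer !mulr_sumr -big_split; apply: eq_bigr => y _ /=; ring.
Qed.

Lemma iter_transfer_comb n (a b : R) f g x :
  iter n K (fun y => a * f y + b * g y) x = a * iter n K f x + b * iter n K g x.
Proof.
elim: n x => //= n IH x; rewrite -transfer_comb.
by congr (K _ x); apply/funext.
Qed.

Lemma occupationS n f x :
  occupation p nb n.+1 f x = f x + K (occupation p nb n f) x.
Proof.
rewrite /occupation big_ord_recl /=; congr (_ + _).
rewrite /K /transfer; under [RHS]eq_bigr do rewrite mulr_sumr.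
by rewrite exchange_big.
Qed.

Lemma occupation_recr n f x :
  occupation p nb n.+1 f x = occupation p nb n f x + iter n K f x.
Proof. by rewrite /occupation big_ord_recr. Qed.

Lemma le_occupation n m f x : (forall y, 0 <= f y) -> (n <= m)%N ->
  occupation p nb n f x <= occupation p nb m f x.
Proof.
move=> f0 /subnK <-; elim: (m - n)%N => // k; rewrite addSn occupation_recr.
by move/le_trans; apply; rewrite lerDl iter_transfer_ge0.
Qed.

Lemma occupation_ge0 n f x : (forall y, 0 <= f y) -> 0 <= occupation p nb n f x.
Proof. by move=> f0; apply: sumr_ge0 => i _; exact: iter_transfer_ge0. Qed.

Hypothesis p_le1 : forall x, \sum_(y <- nb x) p x y <= 1.

Lemma transfer_le c f x :
  0 <= c -> (forall y, f y <= c) -> K f x <= c.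
Proof.
move=> c0 fc; apply: (@le_trans _ _ (\sum_(y <- nb x) p x y * c)).
  by apply: ler_sum => y _; exact: ler_wpM2l.
by rewrite -mulr_suml -[leRHS]mul1r ler_wpM2r.
Qed.

Lemma iter_transfer1_antitone n m x : (n <= m)%N ->
  iter m K (fun=> 1) x <= iter n K (fun=> 1) x.
Proof.
move=> /subnK <-; elim: (m - n)%N => // k; rewrite addSn; apply: le_trans.
by rewrite iterSr; apply: le_iter_transfer => y; exact: transfer_le.
Qed.

Lemma charac_ge0 (F : seq S) x : 0 <= charac F x.
Proof. by rewrite /charac ler0n. Qed.

(** Maximum principle: from a point outside [F] no visit is counted at once, so
    the occupation of [F] is an average of its values one step later and cannot
    exceed the bound that holds on [F]. *)
Lemma occupation_max_principle (F : seq S) n M : 0 <= M ->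
  (forall y, y \in F -> occupation p nb n (charac F) y <= M) ->
  forall x, occupation p nb n (charac F) x <= M.
Proof.
move=> M0; elim: n => [|n IH] H x; first by rewrite /occupation big_ord0.
have [xF|xF] := boolP (x \in F); first exact: H.
rewrite occupationS /charac (negPf xF) add0r; apply: transfer_le => // y.
apply: IH => {}y yF; apply: le_trans (H _ yF).
by apply: le_occupation => // z; exact: charac_ge0.
Qed.

(** During the first [m] steps at most [m] visits are counted; only the mass that
    survives them, measured by the iterate, counts more. *)
Lemma occupation_shift n m f x : (forall y, f y <= 1) ->
  occupation p nb (n + m) f x
    <= m%:R + iter m K (occupation p nb n f) x.
Proof.
move=> f1; elim: m x => [|m IH] x; first by rewrite addn0 add0r.
rewrite addnS occupationS -natr1 [_ + 1]addrC -addrA lerD//=.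
apply: le_trans (le_transfer _ _ IH x) _.
have := transfer_comb m%:R 1 (fun=> 1) (iter m K (occupation p nb n f)) x.
under eq_fun do rewrite mulr1 mul1r.
by move=> ->; rewrite mul1r lerD2r ler_piMr// transfer_le.
Qed.

(** The chain is killed where its rows sum to less than one. If from every point
    of [F] it has died within [m] steps with probability at least [delta], the
    number of blocks of [m] steps that start in [F] is dominated by a geometric
    variable, whence the bound [m / delta], the fixed point of
    [C = m + (1 - delta) * C]. *)
Lemma occupation_bound (F : seq S) m delta : (0 < m)%N -> 0 < delta ->
  (forall y, y \in F -> iter m K (fun=> 1) y <= 1 - delta) ->
  forall n x, occupation p nb n (charac F) x <= m%:R / delta.
Proof.
move=> m0 d0 HF; have C0 : 0 <= m%:R / delta by exact: divr_ge0 (ler0n _ _) (ltW d0).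
elim=> [|n IH] x; first by rewrite /occupation big_ord0.
apply: (@le_trans _ _ (occupation p nb (n + m) (charac F) x)).
  by apply: le_occupation; [exact: charac_ge0 | rewrite -addn1 leq_add2l].
apply: occupation_max_principle => // y yF.
apply: le_trans (occupation_shift n m _ _ _) _.
  by move=> z; rewrite /charac; case: (_ \in _).
have -> : m%:R / delta = m%:R + (m%:R / delta) * (1 - delta).
  by field; rewrite gt_eqF.
rewrite lerD2l; apply: (@le_trans _ _ ((m%:R / delta) * iter m K (fun=> 1) y)).
  rewrite -[leRHS]addr0 -[X in _ <= _ + X](mul0r (iter m K (fun=> 1) y)).
  rewrite -iter_transfer_comb; apply: le_iter_transfer => z.
  by rewrite mul0r addr0 mulr1.
by rewrite ler_wpM2l// HF.
Qed.

Hypothesis dies : forall x, exists n, iter n K (fun=> 1) x < 1.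

Lemma dies_uniformly (F : seq S) : exists m delta,
  [/\ (0 < m)%N, 0 < delta &
      forall y, y \in F -> iter m K (fun=> 1) y <= 1 - delta].
Proof.
elim: F => [|x F [m [d [m0 d0 H]]]]; first by exists 1%N, 1.
have [n Hn] := dies x.
exists (maxn m n), (Num.min d (1 - iter n K (fun=> 1) x)); split.
- by rewrite leq_max m0.
- by rewrite lt_min d0 subr_gt0.
- move=> y; rewrite inE => /orP[/eqP ->|yF].
    apply: le_trans (iter_transfer1_antitone _ _ _ (leq_maxr _ _)) _.
    by rewrite lerBrDr addrC -lerBrDr ge_min lexx orbT.
  apply: le_trans (iter_transfer1_antitone _ _ _ (leq_maxl _ _)) _.
  apply: le_trans (H _ yF) _.
  by rewrite lerB// ge_min lexx.
Qed.

Lemma occupation_bounded (F : seq S) :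
  exists C, forall n x, occupation p nb n (charac F) x <= C.
Proof.
have [m [delta [m0 d0 HF]]] := dies_uniformly F.
by exists (m%:R / delta) => n x; exact: occupation_bound.
Qed.

Section Drift.
Context (V r : S -> R) (F : seq S) (eps b : R).
Hypothesis V_ge0 : forall x, 0 <= V x.
Hypothesis r_ge0 : forall x, 0 <= r x.
Hypothesis eps_gt0 : 0 < eps.
Hypothesis b_ge0 : 0 <= b.
Hypothesis V_drift : forall x, K V x <= V x - eps * r x + b * charac F x.

(** Dynkin's formula as an inequality: summing the drift condition along the chain
    telescopes in [V]. *)
Lemma drift_iter n x :
  eps * occupation p nb n r x + iter n K V x
    <= V x + b * occupation p nb n (charac F) x.
Proof.
elim: n => [|n IH].
  by rewrite /occupation !big_ord0 !mulr0 add0r addr0.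
have step : iter n.+1 K V x
    <= iter n K V x - eps * iter n K r x + b * iter n K (charac F) x.
  rewrite iterSr; apply: le_trans (le_iter_transfer n _ _ V_drift x) _.
  have -> : iter n K V x - eps * iter n K r x + b * iter n K (charac F) x =
      1 * iter n K (fun y => 1 * V y + (- eps) * r y) x
      + b * iter n K (charac F) x.
    by rewrite iter_transfer_comb !mul1r mulNr.
  rewrite -iter_transfer_comb.
  by apply: le_iter_transfer => y; rewrite !mul1r mulNr.
rewrite !occupation_recr; move: step IH; lra.
Qed.

Lemma drift_bounds x : exists C, forall n,
  occupation p nb n r x <= C /\ iter n K V x <= C.
Proof.
have [C HC] := occupation_bounded F.
exists ((V x + b * C) / eps + (V x + b * C)) => n.
have D0 : 0 <= V x + b * C.
  apply: addr_ge0 => //; apply: mulr_ge0 => //; apply: le_trans (HC 0%N x).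
  by rewrite /occupation big_ord0.
have D : eps * occupation p nb n r x + iter n K V x <= V x + b * C.
  by apply: le_trans (drift_iter n x) _; rewrite lerD2l ler_wpM2l.
have V0 := iter_transfer_ge0 n _ V_ge0 x; have r0 := occupation_ge0 n _ x r_ge0.
split.
  apply: (@le_trans _ _ ((V x + b * C) / eps)); last by rewrite lerDl.
  rewrite ler_pdivlMr// mulrC; lra.
have := mulr_ge0 (ltW eps_gt0) r0.
have : 0 <= (V x + b * C) / eps by rewrite divr_ge0// ltW.
lra.
Qed.

Hypothesis V_coercive : forall M, finite_set [set x | V x <= M].

(** The mass surviving [n] steps sits either on a level set of [V], whose expected
    number of visits is finite, or where [V] is large, which is rare by Markov's
    inequality because the expectation of [V] along the chain is bounded. *)
Lemma survival_cvg0 x (eta : R) : 0 < eta ->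
  exists n, iter n K (fun=> 1) x <= eta.
Proof.
move=> eta0; have [C HC] := drift_bounds x.
have C0 : 0 <= C.
  by have [+ _] := HC 0%N; rewrite /occupation big_ord0.
pose M := 2 * (C + 1) / eta.
have M0 : 0 < M by rewrite divr_gt0// mulr_gt0//; lra.
have /finite_seqP[F' HF'] := V_coercive M.
have [D HD] := occupation_bounded F'.
have [n Hn] : exists n, iter n K (charac F') x <= eta / 2.
  apply/not_existsP => H.
  have {}H n : (eta / 2) * n%:R <= occupation p nb n (charac F') x.
    elim: n => [|n IH]; first by rewrite mulr0 /occupation big_ord0.
    rewrite occupation_recr -(natr1 n) mulrDr mulr1 lerD// ltW// ltNge.
    by apply/negP; exact: H.
  have D0 : 0 <= D by apply: le_trans (HD 0%N x); rewrite /occupation big_ord0.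
  have e2 : 0 < eta / 2 by rewrite divr_gt0.
  have := archi_boundP (divr_ge0 D0 (ltW e2)).
  rewrite ltr_pdivrMr// mulrC; apply/negP; rewrite -leNgt.
  exact: le_trans (H _) (HD _ _).
(* Pointwise, 1 is at most the indicator of the level set plus V / M. *)
exists n; apply: (@le_trans _ _ (1 * iter n K (charac F') x
                                 + M^-1 * iter n K V x)).
  rewrite -iter_transfer_comb; apply: le_iter_transfer => y.
  rewrite mul1r /charac; have [_|yF] := boolP (y \in _).
    by rewrite lerDl mulr_ge0// invr_ge0 ltW.
  rewrite add0r mulrC ler_pdivlMr// mul1r leNgt; apply: contra yF => /ltW yM.
  by have : [set x | V x <= M] y by []; rewrite HF'.
rewrite mul1r [leRHS]splitr lerD// mulrC ler_pdivrMr// /M.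
have [_ h] := HC n; apply: le_trans h _.
rewrite (_ : eta / 2 * _ = C + 1); last by field; rewrite gt_eqF.
by rewrite lerDl.
Qed.

End Drift.
End Transfer.

(** * Locally finite rates and the embedded jump chain *)

(** Every state [x] has a finite list [nb x] of possible successors. It turns the
    unconditional sums over the state space into finite sums. *)
Record locally_finite {R : realType} {S : countType} (q : S -> S -> R)
    (nb : S -> seq S) : Prop := LocallyFinite {
  lf_ge0 : forall x y, 0 <= q x y;
  lf_uniq : forall x, uniq (nb x);
  lf_irrefl : forall x, x \notin nb x;
  lf_supp : forall x y, y != x -> y \notin nb x -> q x y = 0 }.

Definition communicating {R : realType} {S : countType} (q : S -> S -> R)
    (nb : S -> seq S) : Prop :=
  forall x y, exists2 s,
    path (fun a b => (b \in nb a) && (0 < q a b)) x s & last x s = y.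

Lemma ereal_sup_lt0 {R : realType} (A : set (\bar R)) : (ereal_sup A < 0)%E ->
  exists2 eps : R, 0 < eps & forall a, A a -> (a <= (- eps)%:E)%E.
Proof.
case: (ereal_sup A) (@ereal_sup_ubound R A) => [l Hl|//|H _].
  rewrite lte_fin => l0; exists (- l); rewrite ?oppr_gt0// opprK.
  by move=> a /Hl.
by exists 1 => // a /H; rewrite leeNy_eq => /eqP ->; exact: leNye.
Qed.

Section LocallyFinite.
Context {R : realType} {S : countType} (q : S -> S -> R) (nb : S -> seq S).
Hypothesis lf : locally_finite q nb.
Hypothesis exit_gt0 : forall x, 0 < exit_rate q x.

Lemma esum_neighbours (f : S -> R) x : (forall y, 0 <= f y) ->
  (forall y, y != x -> y \notin nb x -> f y = 0) ->
  (\esum_(y in [set~ x]) (f y)%:E = (\sum_(y <- nb x) f y)%:E)%E.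
Proof.
move=> f0 fs.
have -> : (\esum_(y in [set~ x]) (f y)%:E
           = \esum_(y in [set` nb x]) (f y)%:E)%E.
  rewrite esum_mkcond [RHS]esum_mkcond; apply: eq_esum => y _.
  have [/set_mem/= ynx|] := boolP (y \in [set~ x]); last first.
    rewrite notin_setE/= => /contrapT ->; case: ifPn => // /set_mem/= h.
    by have := lf_irrefl _ _ lf x; rewrite h.
  case: ifPn => //; rewrite notin_setE/= => /negP h.
  by rewrite fs//; exact/eqP.
rewrite esum_fset; [|exact: finite_seq|by move=> y _; rewrite lee_fin].
by rewrite -fsbig_seq ?sumEFin//; exact: (lf_uniq _ _ lf).
Qed.

Lemma exit_rateE x : exit_rate q x = \sum_(y <- nb x) q x y.
Proof.
rewrite /exit_rate esum_neighbours//; first by move=> y; exact: (lf_ge0 _ _ lf).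
by move=> y; exact: (lf_supp _ _ lf).
Qed.

Lemma jump_probE x y : y \in nb x -> jump_prob q x y = q x y / exit_rate q x.
Proof.
move=> yx; rewrite /jump_prob gt_eqF//; case: eqP => // xy.
by have := lf_irrefl _ _ lf x; rewrite {1}xy yx.
Qed.

Lemma jump_prob_ge0 x y : 0 <= jump_prob q x y.
Proof.
rewrite /jump_prob gt_eqF//; case: eqP => // _.
by rewrite divr_ge0// ?(lf_ge0 _ _ lf)// ltW.
Qed.

Lemma transfer_jump (f : S -> R) x : transfer (jump_prob q) nb f x =
  (\sum_(y <- nb x) q x y * f y) / exit_rate q x.
Proof.
rewrite /transfer mulr_suml big_seq [RHS]big_seq; apply: eq_bigr => y yx.
by rewrite jump_probE// mulrAC.
Qed.

Lemma jump_prob_sum1 x : \sum_(y <- nb x) jump_prob q x y = 1.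
Proof.
have := transfer_jump (fun=> 1) x; rewrite /transfer.
under eq_bigr do rewrite mulr1.
under [in RHS]eq_bigr do rewrite mulr1.
by rewrite -exit_rateE divff// gt_eqF.
Qed.

Lemma driftE (V : S -> R) x :
  drift q V x = (\sum_(y <- nb x) (V y - V x) * q x y)%:E.
Proof.
have q0 y : y != x -> y \notin nb x -> (V y - V x) * q x y = 0.
  by move=> yx ynb; rewrite (lf_supp _ _ lf) ?mulr0.
rewrite /drift (esum_neighbours (fun y => Num.max _ 0)); last 2 first.
- by move=> y; rewrite le_max lexx orbT.
- by move=> y yx ynb; rewrite q0// maxxx.
rewrite (esum_neighbours (fun y => Num.max (- _) 0)); last 2 first.
- by move=> y; rewrite le_max lexx orbT.
- by move=> y yx ynb; rewrite q0// oppr0 maxxx.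
rewrite -EFinB -sumrB; congr (_%:E); apply: eq_bigr => y _.
set c := _ * _; have [c0|c0] := leP 0 c.
  by rewrite max_r ?oppr_le0// subr0.
by rewrite max_l ?oppr_ge0 ?ltW// sub0r opprK.
Qed.

(** Restricting the successors to those different from [x0] kills the jump chain
    when it enters [x0], so that iterates of [transfer] describe an excursion. *)
Definition avoid x0 x : seq S := [seq y <- nb x | y != x0].

Let p := jump_prob q.

Lemma avoid_le x0 (f : S -> R) x : (forall y, 0 <= f y) ->
  transfer p (avoid x0) f x <= transfer p nb f x.
Proof.
move=> f0; rewrite /transfer big_filter big_mkcond /=.
by apply: ler_sum => y _; case: ifP => // _; rewrite mulr_ge0// jump_prob_ge0.
Qed.

Lemma avoid_prob_le1 x0 x : \sum_(y <- avoid x0 x) p x y <= 1.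
Proof.
rewrite -(jump_prob_sum1 x).
have := avoid_le x0 (fun=> 1) x (fun=> ler01); rewrite /transfer.
by under eq_bigr do rewrite mulr1; under [leRHS]eq_bigr do rewrite mulr1.
Qed.

(** Following the path costs the mass that it carries into [x0]: a survival
    probability smaller than one at the second point of the path forces one
    smaller than one at the first, since all others are at most one. *)
Lemma avoid_dies_path x0 s x : s != [::] ->
  path (fun a b => (b \in nb a) && (0 < q a b)) x s -> last x s = x0 ->
  iter (size s) (transfer p (avoid x0)) (fun=> 1) x < 1.
Proof.
elim: s x => // z s IH x _ /= /andP[/andP[zx qxz] zs] sx0.
rewrite -[ltRHS](jump_prob_sum1 x) /transfer big_filter big_mkcond /=.
have pz : 0 < p x z by rewrite /p jump_probE// divr_gt0.
have le1 y : iter (size s) (transfer p (avoid x0)) (fun=> 1) y <= 1.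
  have := iter_transfer1_antitone p (avoid x0) jump_prob_ge0
    (avoid_prob_le1 x0) _ _ y (leq0n (size s)); exact.
rewrite (bigD1_seq z) ?(lf_uniq _ _ lf)//= [ltRHS](bigD1_seq z)/=; last 2 first.
- by [].
- exact: (lf_uniq _ _ lf).
apply: ltr_leD.
  case: ifP => [/eqP zx0|//]; rewrite -[ltRHS]mulr1 ltr_pM2l//.
  by apply: IH => //; case: s sx0 {zs le1} => //= /zx0.
apply: ler_sum => y _; case: ifP => _; last exact: jump_prob_ge0.
by rewrite -[leRHS]mulr1 ler_wpM2l// jump_prob_ge0.
Qed.

Hypothesis comm : communicating q nb.

(** The first step away from [x] makes the path nonempty, which is what is needed
    when [x] is [x0] itself. *)
Lemma avoid_dies x0 x :
  exists n, iter n (transfer p (avoid x0)) (fun=> 1) x < 1.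
Proof.
have [z zx qz] : exists2 z, z \in nb x & 0 < q x z.
  apply/not_exists2P => H; have := exit_gt0 x; rewrite exit_rateE big_seq big1 ?ltxx//.
  move=> y yx; apply/eqP; rewrite eq_le (lf_ge0 _ _ lf) andbT leNgt.
  by apply/negP; have [] := H y.
have [s ps ls] := comm z x0.
exists (size (z :: s)); apply: avoid_dies_path => //=.
by rewrite zx qz.
Qed.

(** Dividing the drift by the exit rate passes from continuous time to the jump
    chain: one jump from [x] lasts [(exit_rate q x)^-1] on average, so the drift
    [- eps] per unit of time becomes [- eps * (exit_rate q x)^-1] per jump. The
    function is shifted to be nonnegative, and the error on the finite
    exceptional set is absorbed into [b]. *)
Lemma lyapunov_jump_chain (V : S -> R) : lyapunov q V ->
  exists (W : S -> R) F eps b,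
    [/\ forall x, 0 <= W x, 0 < eps, 0 <= b,
        forall M, finite_set [set x | W x <= M] &
        forall x, transfer p nb W x
                    <= W x - eps * (exit_rate q x)^-1 + b * charac F x].
Proof.
case=> _ F2 [S0 /finite_seqP[F HF] F3].
have [c Hc] : exists c, forall x, 0 <= V x + c.
  have /finite_seqP[G HG] := F2 0.
  exists (\sum_(y <- G) `|V y|) => x; have [Vx|Vx] := leP (V x) 0; last first.
    by rewrite addr_ge0// ?sumr_ge0// ltW.
  have xG : x \in G by have : [set x | V x <= 0] x by []; rewrite HG.
  rewrite (big_rem x)//= addrA addr_ge0 ?sumr_ge0//.
  by rewrite ler0_norm// subrr.
have [eps eps0 Heps] : exists2 eps : R, 0 < eps &
    forall x, x \notin F -> (drift q V x <= (- eps)%:E)%E.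
  have [eps eps0 Heps] := ereal_sup_lt0 _ F3; exists eps => // x xF.
  by apply: Heps; exists x => //; rewrite HF/=; exact/negP.
pose W x := V x + c.
have TW x : transfer p nb W x = W x + fine (drift q V x) / exit_rate q x.
  rewrite transfer_jump driftE /=.
  have -> : \sum_(y <- nb x) q x y * W y
      = W x * exit_rate q x + \sum_(y <- nb x) (V y - V x) * q x y.
    rewrite exit_rateE mulr_sumr -big_split; apply: eq_bigr => y _ /=.
    rewrite /W; ring.
  by rewrite mulrDl mulfK// gt_eqF.
pose err x := fine (drift q V x) / exit_rate q x + eps * (exit_rate q x)^-1.
exists W, F, eps, (\sum_(y <- F) `|err y|); split => //.
- by rewrite sumr_ge0.
- move=> M; apply: sub_finite_set (F2 (M - c)) => x /=.
  by rewrite /W lerBrDr.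
move=> x; rewrite TW -[leRHS]addrA lerD2l /charac.
have [xF|xF] := boolP (x \in F).
  rewrite mulr1 addrC -lerBlDr opprK; apply: le_trans (ler_norm _) _.
  by rewrite (big_rem x)//= lerDl sumr_ge0.
rewrite mulr0 addr0 -mulNr; apply: ler_wpM2r; first by rewrite invr_ge0 ltW.
by have := Heps _ xF; rewrite driftE lee_fin.
Qed.

End LocallyFinite.

(** * Finite paths and the law of the minimal construction *)

Section Paths.
Context {R : realType} {S : countType}.
Implicit Types (p : S -> S -> R) (nb : S -> seq S) (x y : S) (s : seq S).

(** Successors are appended at the end, so that the last point of a path is where
    the next factor of an iterated kernel applies. *)
Definition paths nb x n : seq (seq S) :=
  iter n (fun ss => [seq rcons s y | s <- ss, y <- nb (last x s)]) [:: [:: x]].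

Definition path_weight p x s : R :=
  \prod_(i < (size s).-1) p (nth x s i) (nth x s i.+1).

Lemma size_paths nb x n s : s \in paths nb x n -> size s = n.+1.
Proof.
elim: n s => [|n IH] s /=; first by rewrite inE => /eqP ->.
by move=> /allpairsPdep[t [y [/IH st _ ->]]]; rewrite size_rcons st.
Qed.

Lemma head_paths nb x n s : s \in paths nb x n -> nth x s 0 = x.
Proof.
elim: n s => [|n IH] s /=; first by rewrite inE => /eqP ->.
move=> /allpairsPdep[t [y [tp _ ->]]].
by rewrite nth_rcons (size_paths _ _ _ _ tp)/= IH.
Qed.

Lemma uniq_paths nb x n : (forall y, uniq (nb y)) -> uniq (paths nb x n).
Proof.
move=> unb; elim: n => //= n IH.
apply: allpairs_uniq_dep => // -[s y] [t z] /= _ _ /rcons_inj[-> ->].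
by [].
Qed.

Lemma mem_paths nb x n (u : nat -> S) : mkseq u n.+1 \in paths nb x n <->
  u 0%N = x /\ forall i, (i < n)%N -> u i.+1 \in nb (u i).
Proof.
elim: n => [|n IH].
  rewrite /paths /mkseq /= inE; split; first by move=> /eqP[->].
  by move=> [u0 _]; rewrite u0.
have lastu : last x (mkseq u n.+1) = u n by rewrite mkseqS last_rcons.
rewrite [paths _ _ _]/= mkseqS; split.
  move=> /allpairsPdep[s [y [sp ys /rcons_inj[su uy]]]].
  move: sp ys; rewrite -su -uy lastu => /IH[u0 H] un.
  by split=> // i; rewrite ltnS leq_eqVlt => /orP[/eqP ->//|/H].
move=> [u0 H]; apply/allpairsPdep; exists (mkseq u n.+1), (u n.+1).
by rewrite lastu H//; split => //; apply/IH; split=> // i /ltnW/H.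
Qed.

Lemma path_weight_rcons p x s y : (0 < size s)%N ->
  path_weight p x (rcons s y) = path_weight p x s * p (last x s) y.
Proof.
case: s => // a s _; rewrite /path_weight size_rcons /= big_ord_recr /=.
rewrite -rcons_cons !nth_rcons /= ltnS leqnn ltnn eqxx; congr (_ * p _ _).
  apply: eq_bigr => i _; rewrite -rcons_cons !nth_rcons /= ltnS.
  by rewrite ltnW ?ltn_ord// !ltnS ltn_ord.
by rewrite -[size s]/(size (a :: s)).-1 nth_last.
Qed.

Lemma sum_paths p nb (f : S -> R) x n :
  \sum_(s <- paths nb x n) path_weight p x s * f (last x s)
  = iter n (transfer p nb) f x.
Proof.
elim: n f => [|n IH] f.
  by rewrite /paths /= big_seq1 /path_weight /= big_ord0 mul1r.
rewrite iterSr -IH /= big_allpairs_dep big_seq [RHS]big_seq.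
apply: eq_bigr => s sp; rewrite /transfer mulr_sumr; apply: eq_bigr => y _.
by rewrite last_rcons path_weight_rcons ?(size_paths _ _ _ _ sp)// mulrA.
Qed.

End Paths.

Section Law.
Context {R : realType} {S : countType} (q : S -> S -> R) (x : S)
  {d : measure_display} {T : measurableType d} (P : probability T R)
  (Y : nat -> T -> S) (H : nat -> T -> \bar R).
Hypothesis mc : minimal_construction q x P Y H.

(** Only the last holding time carries a level different from [0]: this is the
    shape needed to bound the holding time at step [n] given the path up to [n].
    The level [0] for the other ones is as close as the law, which speaks of
    strict inequalities only, comes to no condition at all. *)
Definition cylinder (s : seq S) (a : R) : set T :=
  [set w | forall i, (i <= (size s).-1)%N -> Y i w = nth x s i /\
    ((if i == (size s).-1 then a else 0)%:E < H i w)%E].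

Lemma measurable_hold_gt i a : measurable [set w | (a < H i w)%E].
Proof.
rewrite -[X in measurable X]setTI; apply: emeasurable_fun_o_infty => //.
exact: (mc_measurable_hold mc).
Qed.

Lemma measurable_cylinder s a : measurable (cylinder s a).
Proof.
rewrite (_ : cylinder s a = \bigcap_(i in [set i | (i <= (size s).-1)%N])
   (Y i @^-1` [set nth x s i] `&`
    [set w | (if i == (size s).-1 then a else 0)%:E < H i w]%E)); last first.
  by apply/seteqP; split => w h i /h.
apply: bigcap_measurableType => i _; apply: measurableI.
  exact: (mc_measurable_jump mc).
exact: measurable_hold_gt.
Qed.

Lemma cylinder_prob s a : 0 <= a -> nth x s 0 = x ->
  P (cylinder s a) = (path_weight (jump_prob q) x s
                      * expR (- (exit_rate q (nth x s (size s).-1) * a)))%:E.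
Proof.
move=> a0 s0; set n := (size s).-1.
have t0 i : 0 <= (if i == n then a else 0) by case: ifP.
have := mc_law mc n (nth x s) t0; rewrite -/(cylinder s a) => ->.
rewrite s0 eqxx mul1r; congr (_ * _)%:E.
rewrite big_ord_recr /= eqxx big1 ?mul1r// => i _.
by rewrite (ltn_eqF (ltn_ord i)) mulr0 oppr0 expR0.
Qed.

Lemma cylinder_paths_mkseq nb n w a s : s \in paths nb x n ->
  cylinder s a w -> s = mkseq (Y^~ w) n.+1.
Proof.
move=> sp cw; have ss := size_paths _ _ _ _ sp.
apply: (@eq_from_nth _ x); first by rewrite size_mkseq ss.
move=> i; rewrite ss => ilt; rewrite nth_mkseq//.
by have [] := cw i; rewrite ?ss.
Qed.

Lemma trivIset_cylinder nb n a :
  trivIset [set` paths nb x n] (fun s => cylinder s a).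
Proof.
move=> s t /= sp tp [w [sw tw]].
by rewrite (cylinder_paths_mkseq _ _ _ _ _ sp sw)
           (cylinder_paths_mkseq _ _ _ _ _ tp tw).
Qed.

(** The first [n] jumps follow [nb] and the first [n.+1] holding times are
    positive; written as a finite disjoint union so that its probability is a
    finite sum. *)
Definition along nb n : set T :=
  \bigcup_(s in [set` paths nb x n]) cylinder s 0.

Lemma measurable_along nb n : measurable (along nb n).
Proof.
apply: fin_bigcup_measurable => [|s _]; first exact: finite_seq.
exact: measurable_cylinder.
Qed.

Lemma along_prob nb n : (forall y, uniq (nb y)) ->
  P (along nb n) = (iter n (transfer (jump_prob q) nb) (fun=> 1) x)%:E.
Proof.
move=> unb; rewrite /along measure_fin_bigcup; [|exact: finite_seq| |]; last 2 first.
- exact: trivIset_cylinder.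
- by move=> s _; exact: measurable_cylinder.
rewrite -fsbig_seq ?uniq_paths// -sum_paths -sumEFin big_seq [RHS]big_seq.
apply: eq_bigr => s sp.
apply: etrans (cylinder_prob s 0 (lexx _) (head_paths _ _ _ _ sp)) _.
by rewrite mulr0 oppr0 expR0.
Qed.

Lemma alongE nb n w : along nb n w <->
  [/\ Y 0%N w = x, forall i, (i <= n)%N -> (0 < H i w)%E &
      forall i, (i < n)%N -> Y i.+1 w \in nb (Y i w)].
Proof.
split.
  move=> [s /= sp sw]; have ss := size_paths _ _ _ _ sp.
  have := sp; rewrite (cylinder_paths_mkseq _ _ _ _ _ sp sw) => /mem_paths[u0 hu].
  split => // i ilen; have [] := sw i; rewrite ss// => _; by case: ifP.
move=> [Y0 H0 HY]; have sp : mkseq (Y^~ w) n.+1 \in paths nb x n.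
  exact/mem_paths.
exists (mkseq (Y^~ w) n.+1) => // i; rewrite size_mkseq => ilen.
by rewrite nth_mkseq//; split => //; case: ifP => _; exact: H0.
Qed.

End Law.

(** * The process read off its jumps *)

Section Process.
Context {R : realType} {S : countType} {T : Type}
  (Y : nat -> T -> S) (H : nat -> T -> \bar R).
Hypothesis H_ge0 : forall n w, (0 <= H n w)%E.

Lemma jump_timeS n w : (jump_time H n.+1 w = jump_time H n w + H n w)%E.
Proof. by rewrite /jump_time big_ord_recr. Qed.

Lemma jump_time_ge0 n w : (0 <= jump_time H n w)%E.
Proof. exact: sume_ge0. Qed.

Lemma le_jump_time m n w : (m <= n)%N -> (jump_time H m w <= jump_time H n w)%E.
Proof.
move=> /subnK <-; elim: (n - m)%N => [//|k IH].
by rewrite addSn jump_timeS (le_trans IH)// leeDl.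
Qed.

(** The jump times increase, so at most one index satisfies the condition that
    defines the process, and the choice made by [xget] is forced. *)
Lemma processE n t w :
  (jump_time H n w <= t%:E < jump_time H n.+1 w)%E ->
  process Y H t w = Some (Y n w).
Proof.
move=> /andP[nt tn]; apply: xget_subset1.
  by exists n => //=; rewrite nt tn.
have uniq_n k : (jump_time H k w <= t%:E < jump_time H k.+1 w)%E -> k = n.
  move=> /andP[kt tk]; case: (ltngtP k n) => // /le_jump_time h.
    by have := lt_le_trans tk (le_trans (h w) nt); rewrite ltxx.
  by have := lt_le_trans tn (le_trans (h w) kt); rewrite ltxx.
by move=> _ _ [k /= /uniq_n -> <-] [l /= /uniq_n -> <-].
Qed.

Lemma process_SomeE t y : [set w | process Y H t w = Some y] =
  \bigcup_n (Y n @^-1` [set y] `&`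
    ([set w | (jump_time H n w <= t%:E)%E] `&`
     [set w | (t%:E < jump_time H n.+1 w)%E])).
Proof.
apply/seteqP; split => w /=.
  rewrite /process; case: xgetP => [z -> [n /= /andP[n1 n2] <-] [yn]|_ //].
  by exists n.
move=> [n _ [yn [n1 n2]]]; move: yn n1 n2 => /= yn n1 n2; rewrite (processE n) ?n1//.
by rewrite yn.
Qed.

(** A positive holding time is needed: otherwise the process does not show the
    state [Y n w] at the jump time [n]. *)
Lemma return_time_le n x w : (0 < n)%N -> Y n w = x -> (0 < H n w)%E ->
  (return_time Y H x w <= jump_time H n w)%E.
Proof.
move=> n0 Yn Hn; move: (jump_time_ge0 n w).
case E: (jump_time H n w) => [t| |] // t0; last by rewrite leey.
apply: ereal_inf_lbound; exists t => //; split.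
  by rewrite -E le_jump_time.
rewrite (processE n) ?Yn// E lexx jump_timeS E/=.
by rewrite lteDl.
Qed.

End Process.

Section Hold.
Context {R : realType}.

Lemma nneseries_le (u : nat -> \bar R) (C : \bar R) : (forall n, (0 <= u n)%E) ->
  (forall n, (\sum_(0 <= i < n) u i <= C)%E) -> (\sum_(i <oo) u i <= C)%E.
Proof.
move=> u0 uC; apply: lime_le; first by apply: is_cvg_nneseries => n _ _.
by apply: nearW => n; exact: uC.
Qed.

(** A discrete layer-cake formula. Taking for the mesh [r] the mean of an
    exponential variable [h], the terms of the sum have expectations
    [r * expR (- m)], and the total is a constant multiple of the mean. *)
Lemma le_sum_tail (h : \bar R) (r : R) : (0 <= h)%E -> 0 < r ->
  (h <= \sum_(m <oo) (r * ((m%:R * r)%:E < h)%E%:R)%:E)%E.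
Proof.
move=> h0 r0; set u := fun m : nat => (r * ((m%:R * r)%:E < h)%E%:R)%:E.
have u0 n : (0 <= u n)%E by rewrite lee_fin; apply: mulr_ge0; rewrite ?ler0n ?ltW.
have part n : (Order.min h (n%:R * r)%:E <= \sum_(0 <= m < n) u m)%E.
  elim: n => [|n IH]; first by rewrite mul0r big_geq// ge_min lexx orbT.
  rewrite big_nat_recr//= /u; have [hn|hn] := ltP (n%:R * r)%:E h.
    apply: (@le_trans _ _ (n.+1%:R * r)%:E); first by rewrite ge_min lexx orbT.
    move: IH; rewrite (min_r (ltW hn)) => IH.
    by rewrite mulr1 -natr1 mulrDl mul1r EFinD leeD2r.
  by rewrite mulr0 adde0; apply: le_trans IH; rewrite (min_l hn) ge_min lexx.
have le_n n : (Order.min h (n%:R * r)%:E <= \sum_(m <oo) u m)%E.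
  by apply: le_trans (part n) _; apply: nneseries_lim_ge.
have U0 : (0 <= \sum_(m <oo) u m)%E by exact: nneseries_ge0.
suff below U : (0 <= U)%E -> (forall n, (Order.min h (n%:R * r)%:E <= U)%E) ->
  (h <= U)%E by exact: below U0 le_n.
move=> {}U0 {}le_n; case: h h0 {u u0 part} le_n => [h| |]// h0 le_n.
  have := archi_boundP (divr_ge0 h0 (ltW r0)).
  rewrite ltr_pdivrMr// => hn.
  by have := le_n (Num.bound (h / r)); rewrite min_l// lee_fin ltW.
rewrite leye_eq; apply/eqP/eq_infty => t.
have [t0|t0] := leP t 0.
  by apply: le_trans U0; rewrite lee_fin.
have := archi_boundP (divr_ge0 (ltW t0) (ltW r0)).
rewrite ltr_pdivrMr// => hn.
have := le_n (Num.bound (t / r)); rewrite min_r ?leey//; apply: le_trans.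
by rewrite lee_fin ltW.
Qed.

Lemma sum_half_le n : \sum_(0 <= m < n) (2^-1 ^+ m : R) <= 2.
Proof.
have -> : \sum_(0 <= m < n) (2^-1 ^+ m : R) = 2 - 2 * 2^-1 ^+ n.
  elim: n => [|n IH]; first by rewrite big_geq// expr0 mulr1 subrr.
  by rewrite big_nat_recr//= IH exprS; field.
by rewrite gerBl mulr_ge0// exprn_ge0.
Qed.

Lemma expRN_nat_le m : expR (- m%:R) <= 2^-1 ^+ m :> R.
Proof.
rewrite expRN -[m%:R]mulr1 expRM_natl exprVn lef_pV2 ?posrE ?exprn_gt0 ?expR_gt0//.
rewrite lerXn2r ?nnegrE ?expR_ge0//.
exact: expR_ge1Dx.
Qed.

(** The integral of a nonnegative function is a supremum over the simple functions
    below it, which makes it monotone even for functions not known to be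
    measurable, such as the return time. *)
Lemma ge0_integral_mono d (T : measurableType d)
    (mu : {measure set T -> \bar R}) (f g : T -> \bar R) :
  (forall w, 0 <= f w)%E -> (forall w, f w <= g w)%E ->
  (\int[mu]_w f w <= \int[mu]_w g w)%E.
Proof.
move=> f0 fg; have g0 w : (0 <= g w)%E := le_trans (f0 w) (fg w).
rewrite !ge0_integralTE//; apply: le_ereal_sup => _ [h /= hf <-].
by exists h => //= w; exact: le_trans (hf w) (fg w).
Qed.

End Hold.

(** * Irreducibility *)

Section Chain.
Context {R : realType} {S : countType} (q : S -> S -> R) (nb : S -> seq S).
Hypothesis lf : locally_finite q nb.
Hypothesis exit_gt0 : forall x, 0 < exit_rate q x.
Hypothesis comm : communicating q nb.

Section Construction.
Context (x : S) {d : measure_display} {T : measurableType d}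
  (P : probability T R) (Y : nat -> T -> S) (H : nat -> T -> \bar R).
Hypothesis mc : minimal_construction q x P Y H.

Lemma measurable_jump_time n : measurable_fun [set: T] (jump_time H n).
Proof. by apply: emeasurable_sum => i; exact: (mc_measurable_hold mc). Qed.

Lemma measurable_process t y : measurable [set w | process Y H t w = Some y].
Proof.
rewrite process_SomeE; last exact: (mc_hold_ge0 mc).
apply: bigcup_measurable => n _; apply: measurableI.
  exact: (mc_measurable_jump mc).
apply: measurableI.
  by rewrite -[X in measurable X]setTI; apply: emeasurable_fun_infty_c => //;
    exact: measurable_jump_time.
by rewrite -[X in measurable X]setTI; apply: emeasurable_fun_o_infty => //;
  exact: measurable_jump_time.
Qed.

(** The event is contained, for every level [k], in the cylinder over the path cut
    at [i] whose last holding time exceeds [k]; the probability of that cylinder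
    decays exponentially in [k]. *)
Lemma cylinder_hold_infty s i : nth x s 0 = x -> (i < size s)%N ->
  P.-negligible (cylinder x Y H s 0 `&` [set w | H i w = +oo%E]).
Proof.
move=> s0 si; set A := _ `&` _.
have mA : measurable A.
  apply: measurableI; first exact: (measurable_cylinder _ _ _ _ _ mc).
  rewrite (_ : [set w | H i w = +oo%E] = [set: T] `&` [set w | +oo <= H i w]%E).
    by apply: emeasurable_fun_c_infty => //; exact: (mc_measurable_hold mc).
  by rewrite setTI; apply/seteqP; split => w /=; rewrite leye_eq => /eqP.
apply/negligibleP => //; apply/eqP; rewrite -measure_le0.
pose u := take i.+1 s.
have su : size u = i.+1 by rewrite size_takel.
have nu j : (j <= i)%N -> nth x u j = nth x s j by move=> ji; rewrite nth_take.
pose c := path_weight (jump_prob q) x u; pose e := exit_rate q (nth x u i).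
have e0 : 0 < e by exact: exit_gt0.
have c0 : 0 <= c by apply: prodr_ge0 => j _; exact: (jump_prob_ge0 _ _ lf).
have PA k : (P A <= (c * expR (- (e * k%:R)))%:E)%E.
  have := cylinder_prob q x P Y H mc u k%:R (ler0n _ k).
  rewrite su nu// => /(_ s0) <-; apply: le_measure; rewrite ?inE//.
    exact: (measurable_cylinder _ _ _ _ _ mc).
  move=> w [sw Hi] j; rewrite su /= => ji.
  have js : (j <= (size s).-1)%N.
    by rewrite (leq_trans ji)// -ltnS prednK// (leq_ltn_trans _ si).
  have [Yj Hj] := sw j js; rewrite nu//; split => //.
  case: ifP => [/eqP ->|_]; first by rewrite Hi ltry.
  by move: Hj; case: ifP.
apply/lee_addgt0Pr => eps eps0; rewrite add0e.
have [k hk] : exists k : nat, c / (eps * e) < k%:R.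
  by eexists; apply: archi_boundP; rewrite divr_ge0// mulr_ge0// ltW.
apply: le_trans (PA k) _; rewrite lee_fin expRN ler_pdivrMr ?expR_gt0//.
apply: (@le_trans _ _ (eps * (1 + e * k%:R))); last first.
  by rewrite ler_pM2l// expR_ge1Dx.
rewrite ltr_pdivrMr ?mulr_gt0// in hk.
rewrite mulrDr mulr1; apply: ltW; apply: lt_le_trans hk _.
rewrite mulrC -mulrA; lra.
Qed.

(** The chain follows the path [s] with positive probability. On this event, up to
    a null set, the last point of the path is occupied during a nonempty open
    interval of times, which contains a rational time; if all the events at
    rational times were null, so would be their countable union. *)
Lemma process_visits s : path (fun a b => (b \in nb a) && (0 < q a b)) x s ->
  exists2 t : R, 0 <= t & (0 < P [set w | process Y H t w = Some (last x s)])%E.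
Proof.
move=> ps; set y := last x s; set n := size s.
apply/not_exists2P => noT.
have null t : 0 <= t -> P.-negligible [set w | process Y H t w = Some y].
  move=> t0; apply/negligibleP; first exact: measurable_process.
  have [//|/negP] := noT t.
  by rewrite measure_gt0 negbK => /eqP.
pose A := cylinder x Y H (x :: s) 0.
have : (0 < P A)%E.
  rewrite (cylinder_prob q x P Y H mc)//= mulr0 oppr0 expR0 mulr1 lte_fin.
  apply: prodr_gt0 => i _ /=; move/(pathP x): ps => /(_ i (ltn_ord i)).
  by move=> /andP[h1 h2]; rewrite (jump_probE _ _ lf)// divr_gt0.
rewrite measure_gt0 => /eqP; apply; apply: measure_negligible.
  exact: (measurable_cylinder _ _ _ _ _ mc).
pose rt k : set T := if @unpickle rat k is Some r then
  (if 0 <= ratr r :> R then [set w | process Y H (ratr r) w = Some y] else set0)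
  else set0.
have nrt : P.-negligible (\bigcup_k rt k).
  apply: negligible_bigcup => k; rewrite /rt; case: unpickle => [r|]; last first.
    exact: negligible_set0.
  by case: ifP => [r0|_]; [exact: null | exact: negligible_set0].
have ninf : P.-negligible (\bigcup_i (if (i < size (x :: s))%N
    then A `&` [set w | H i w = +oo%E] else set0)).
  apply: negligible_bigcup => i; case: ifP => [is_|_]; last exact: negligible_set0.
  exact: cylinder_hold_infty.
apply: negligibleS (negligibleU nrt ninf) => w Aw.
have [winf|wfin] := pselect (exists2 i, (i < size (x :: s))%N & H i w = +oo%E).
  by right; case: winf => i is_ Hi; exists i => //; rewrite is_.
left.
have Hfin i : (i <= n)%N -> (H i w < +oo)%E.
  move=> ilen; rewrite ltey; apply/eqP => Hi.
  by apply: wfin; exists i => //=.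
have : (0 <= jump_time H n w < +oo)%E.
  rewrite jump_time_ge0 ?lte_sum_pinfty//; last exact: (mc_hold_ge0 mc).
  by move=> i _; apply: Hfin; rewrite ltnW.
case E : (jump_time H n w) => [a| |] /andP[a0 afin] //.
have [Yn Hn] := Aw n (leqnn _); rewrite /= eqxx in Hn.
have := Hfin n (leqnn _); case En : (H n w) Hn => [b| |]// b0 _.
rewrite lte_fin in b0; rewrite lee_fin in a0.
have ab : a < a + b by rewrite ltrDl.
have [r] := rat_in_itvoo ab; rewrite in_itv/= => /andP[ar rb].
exists (pickle r); first exact: I.
rewrite /rt pickleK.
rewrite (le_trans a0 (ltW ar))/=.
rewrite (processE _ _ (mc_hold_ge0 mc) n); last first.
  by rewrite jump_timeS E En lee_fin lte_fin (ltW ar) rb.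
by rewrite Yn /= /y (last_nth x).
Qed.

End Construction.

Theorem communicating_irreducible : irreducible q.
Proof.
move=> x y d T P Y H mc; have [s ps <-] := comm x y.
exact: (process_visits _ _ _ _ mc).
Qed.

End Chain.

(** * Foster's criterion *)

Section Foster.
Context {R : realType} {S : countType} (q : S -> S -> R) (nb : S -> seq S).
Hypothesis lf : locally_finite q nb.
Hypothesis exit_gt0 : forall x, 0 < exit_rate q x.
Hypothesis comm : communicating q nb.

Section Construction.
Context (x : S) {d : measure_display} {T : measurableType d}
  (P : probability T R) (Y : nat -> T -> S) (H : nat -> T -> \bar R).
Hypothesis mc : minimal_construction q x P Y H.

Let mean_hold (y : S) : R := (exit_rate q y)^-1.
Let mean_hold_gt0 y : 0 < mean_hold y. Proof. by rewrite invr_gt0. Qed.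
Let K := transfer (jump_prob q) (avoid nb x).

(** On the event that the excursion has followed [s], the discrete layer-cake
    bound for the holding time at the last point of [s]; elsewhere [0]. *)
Definition path_hold (s : seq S) (w : T) : \bar R :=
  (\sum_(m <oo) (mean_hold (last x s))%:E
    * (\1_(cylinder x Y H s (m%:R * mean_hold (last x s))) w)%:E)%E.

(** A measurable bound for the duration of an excursion from [x], whose integral
    is computed term by term from the law of the cylinders. *)
Definition excursion_hold (w : T) : \bar R :=
  (\sum_(n <oo) \sum_(s <- paths (avoid nb x) x n) path_hold s w)%E.

Lemma path_hold_term_ge0 s m w : (0 <= (mean_hold (last x s))%:E
    * (\1_(cylinder x Y H s (m%:R * mean_hold (last x s))) w)%:E)%E.
Proof. by rewrite mule_ge0// lee_fin ?ltW// indicE ler0n. Qed.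

Lemma path_hold_ge0 s w : (0 <= path_hold s w)%E.
Proof. by apply: nneseries_ge0 => m _ _; exact: path_hold_term_ge0. Qed.

Lemma path_hold_term_measurable s m : measurable_fun [set: T] (fun w =>
  (mean_hold (last x s))%:E
    * (\1_(cylinder x Y H s (m%:R * mean_hold (last x s))) w)%:E)%E.
Proof.
apply: measurable_funeM; apply/measurable_EFinP; apply: measurable_indic.
exact: (measurable_cylinder _ _ _ _ _ mc).
Qed.

Lemma path_hold_measurable s : measurable_fun [set: T] (path_hold s).
Proof.
apply: ge0_emeasurable_sum => [m w _ _|m _]; first exact: path_hold_term_ge0.
exact: path_hold_term_measurable.
Qed.

Lemma excursion_hold_measurable : measurable_fun [set: T] excursion_hold.
Proof.
apply: ge0_emeasurable_sum => [n w _ _|n _].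
  by apply: sume_ge0 => s _; exact: path_hold_ge0.
by apply: emeasurable_sum => s; exact: path_hold_measurable.
Qed.

Lemma excursion_hold_ge0 w : (0 <= excursion_hold w)%E.
Proof.
by apply: nneseries_ge0 => n _ _; apply: sume_ge0 => s _; exact: path_hold_ge0.
Qed.

(** The mean holding times cancel the exit rates, so the cylinder of level
    [m%:R * mean_hold (last x s)] has probability [path_weight * expR (- m%:R)]
    whatever the exit rate, and the geometric series sums to at most [2]. *)
Lemma path_hold_integral n s : s \in paths (avoid nb x) x n ->
  (\int[P]_w path_hold s w
   <= (2 * (path_weight (jump_prob q) x s * mean_hold (last x s)))%:E)%E.
Proof.
move=> sp; have ss := size_paths _ _ _ _ sp.
set r := mean_hold (last x s); set c := path_weight _ x s.
have r0 : 0 < r := mean_hold_gt0 _.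
have c0 : 0 <= c by apply: prodr_ge0 => j _; exact: (jump_prob_ge0 _ _ lf).
rewrite integral_nneseries//; last 2 first.
- by move=> m; exact: path_hold_term_measurable.
- by move=> m w _; exact: path_hold_term_ge0.
have term m : (\int[P]_w (r%:E * (\1_(cylinder x Y H s (m%:R * r)) w)%:E)
               = (r * (c * expR (- m%:R)))%:E)%E.
  have mC := measurable_cylinder _ _ _ _ _ mc s (m%:R * r).
  rewrite ge0_integralZl_EFin//; last 2 first.
  - by apply/measurable_EFinP; exact: measurable_indic.
  - exact: ltW.
  rewrite integral_indic// setIT.
  transitivity (r%:E * P (cylinder x Y H s (m%:R * r)))%E; first by [].
  rewrite (cylinder_prob _ _ _ _ _ mc) ?(head_paths _ _ _ _ sp)//; last first.
    by rewrite mulr_ge0// ltW.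
  have -> : nth x s (size s).-1 = last x s.
    case: s ss {sp r c r0 c0 mC} => // y s _; rewrite /= (last_nth y).
    exact: set_nth_default.
  by rewrite mulrCA /r /mean_hold divff ?mulr1// gt_eqF.
apply: nneseries_le => [m|k]; first by rewrite term lee_fin !mulr_ge0 ?expR_ge0// ltW.
rewrite (eq_bigr _ (fun m _ => term m)) sumEFin lee_fin.
under eq_bigr do rewrite mulrA.
rewrite -mulr_sumr [leRHS]mulrC [r * c]mulrC ler_wpM2l//.
  by rewrite mulr_ge0// ltW.
by apply: le_trans (sum_half_le k); apply: ler_sum => m _; exact: expRN_nat_le.
Qed.

Lemma excursion_hold_integral (C : R) :
  (forall n, occupation (jump_prob q) (avoid nb x) n mean_hold x <= C) ->
  (\int[P]_w excursion_hold w <= (2 * C)%:E)%E.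
Proof.
move=> HC; rewrite integral_nneseries//; last 2 first.
- by move=> n; apply: emeasurable_sum => s; exact: path_hold_measurable.
- by move=> n w _; apply: sume_ge0 => s _; exact: path_hold_ge0.
have term n : (\int[P]_w \sum_(s <- paths (avoid nb x) x n) path_hold s w
               <= (2 * iter n K mean_hold x)%:E)%E.
  rewrite ge0_integral_sum//; last 2 first.
  - by move=> s; exact: path_hold_measurable.
  - by move=> s w _; exact: path_hold_ge0.
  rewrite -sum_paths mulr_sumr -sumEFin big_seq [leRHS]big_seq.
  by apply: lee_sum => s; exact: path_hold_integral.
apply: nneseries_le => [n|k].
  by apply: integral_ge0 => w _; apply: sume_ge0 => s _; exact: path_hold_ge0.
apply: (@le_trans _ _ (\sum_(0 <= n < k) (2 * iter n K mean_hold x)%:E)%E).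
  by apply: lee_sum => n _; exact: term.
rewrite sumEFin lee_fin -mulr_sumr ler_pM2l// big_mkord; exact: HC.
Qed.

Lemma hold_le_path_hold n w : along x Y H (avoid nb x) n w ->
  (H n w <= \sum_(s <- paths (avoid nb x) x n) path_hold s w)%E.
Proof.
move=> aw; have [s /= sp sw] := aw.
have ss := size_paths _ _ _ _ sp.
rewrite (big_rem s)//=; apply: (@le_trans _ _ (path_hold s w)); last first.
  by rewrite leeDl// sume_ge0// => t _; exact: path_hold_ge0.
apply: le_trans (le_sum_tail _ (mean_hold (last x s)) _ _) _ => //.
  exact: (mc_hold_ge0 mc).
apply: lee_nneseries => m _; first by rewrite lee_fin mulr_ge0 ?ler0n// ltW.
rewrite EFinM lee_pmul2l//= ?lte_fin// lee_fin indicE ler_nat.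
case: ltP => //= Hm; rewrite mem_set// => i ilen.
have [Yi Hi] := sw i ilen; split => //; case: ifP => [/eqP ->|]; first by rewrite ss.
by move: Hi; case: ifP.
Qed.

(** If the chain follows its successors forever but does not avoid [x] forever, it
    is at [x] at some first positive step [N], and the return time is at most the
    sum of the holding times before [N], each of which happens on an event where
    [x] is still avoided. *)
Lemma return_time_excursion w :
  (forall n, along x Y H nb n w) -> ~ (forall n, along x Y H (avoid nb x) n w) ->
  (return_time Y H x w <= excursion_hold w)%E.
Proof.
move=> good /existsNP[N0 HN0].
have ex : exists n, `[< ~ along x Y H (avoid nb x) n w >].
  by exists N0; apply/asboolP.
case: (ex_minnP ex) => N /asboolP nN minN.
have alive i : (i < N)%N -> along x Y H (avoid nb x) i w.
  by move=> iN; apply: contrapT => h; have := minN i (asboolT h); rewrite leqNgt iN.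
have [Y0 H0 HY] : [/\ Y 0%N w = x, forall i, (0 < H i w)%E &
    forall i, Y i.+1 w \in nb (Y i w)].
  split; first by have [] := (alongE _ _ _ _ _ _).1 (good 0%N).
    by move=> i; have [_ h _] := (alongE _ _ _ _ _ _).1 (good i); exact: h.
  by move=> i; have [_ _ h] := (alongE _ _ _ _ _ _).1 (good i.+1); exact: h.
case: N nN minN alive => [|N] nN _ alive.
  by exfalso; apply: nN; apply/alongE; split.
have YN : Y N.+1 w = x.
  apply: contrapT => /eqP YN; apply: nN; apply/alongE; split => // i.
  rewrite ltnS leq_eqVlt => /orP[/eqP ->|iN]; first by rewrite mem_filter YN HY.
  by have [_ _ h] := (alongE _ _ _ _ _ _).1 (alive N (ltnSn N)); exact: h.
apply: le_trans (return_time_le _ _ (mc_hold_ge0 mc) N.+1 x w _ YN (H0 _)) _ => //.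
apply: (@le_trans _ _ (\sum_(0 <= n < N.+1)
    \sum_(s <- paths (avoid nb x) x n) path_hold s w)%E).
  rewrite /jump_time big_mkord; apply: lee_sum => i _.
  exact: hold_le_path_hold (alive _ (ltn_ord i)).
by apply: nneseries_lim_ge => n _ _; apply: sume_ge0 => s _; exact: path_hold_ge0.
Qed.

Lemma return_time_ge0 w : (0 <= return_time Y H x w)%E.
Proof.
apply: le_ereal_inf_tmp => _ [t [/= Jt _] <-]; apply: le_trans Jt.
exact: jump_time_ge0 (mc_hold_ge0 mc) _ _.
Qed.

(** The two exceptional events, leaving the successor lists and avoiding [x]
    forever, are null; the bound is made infinite on them. *)
Lemma return_time_integral (C : R) :
  (forall n, occupation (jump_prob q) (avoid nb x) n mean_hold x <= C) ->
  (forall eta, 0 < eta -> exists n, iter n K (fun=> 1) x <= eta) ->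
  (\int[P]_w return_time Y H x w < +oo)%E.
Proof.
move=> HC surv.
have null : P.-negligible ((\bigcup_n (~` along x Y H nb n))
    `|` \bigcap_n along x Y H (avoid nb x) n).
  apply: negligibleU.
    apply: negligible_bigcup => n; apply/negligibleP.
      by apply: measurableC; exact: (measurable_along _ _ _ _ _ mc).
    rewrite -[LHS]/(P (~` along x Y H nb n)) probability_setC; last first.
      exact: (measurable_along _ _ _ _ _ mc).
    rewrite (along_prob _ _ _ _ _ mc); last exact: (lf_uniq _ _ lf).
    have -> : iter n (transfer (jump_prob q) nb) (fun=> 1) x = 1.
      elim: n (x) => //= n IH y.
      rewrite -[RHS](jump_prob_sum1 _ _ lf exit_gt0 y); apply: eq_bigr => z _.
      by rewrite IH mulr1.
    by rewrite subee.
  apply/negligibleP.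
    by apply: bigcap_measurableType => n _; exact: (measurable_along _ _ _ _ _ mc).
  apply/eqP; rewrite -measure_le0; apply/lee_addgt0Pr => eta eta0; rewrite add0e.
  have [n Hn] := surv eta eta0.
  apply: (@le_trans _ _ (P (along x Y H (avoid nb x) n))).
    apply: le_measure; rewrite ?inE; [|exact: (measurable_along _ _ _ _ _ mc)|].
      by apply: bigcap_measurableType => k _; exact: (measurable_along _ _ _ _ _ mc).
    by move=> w; apply.
  rewrite (along_prob _ _ _ _ _ mc) ?lee_fin//.
  by move=> y; rewrite filter_uniq// (lf_uniq _ _ lf).
have [B [mB B0 sB]] := null.
pose g w := (excursion_hold w + (cst +oo \_ B) w)%E.
have h0 w : (0 <= (cst +oo \_ B) w :> \bar R)%E.
  by apply: erestrict_ge0 => t _; exact: leey.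
apply: (@le_lt_trans _ _ (\int[P]_w g w)%E).
  apply: ge0_integral_mono => [w|w]; first exact: return_time_ge0.
  have [wB|wB] := pselect (B w).
    rewrite /g patchE mem_set// addey ?leey// gt_eqF//.
    by rewrite (lt_le_trans _ (excursion_hold_ge0 w))// ltNy0.
  rewrite /g patchE memNset// adde0; apply: return_time_excursion.
    move=> n; apply: contrapT => h; apply: wB; apply: sB; left.
    by exists n.
  by move=> h; apply: wB; apply: sB; right => n _; exact: h.
rewrite ge0_integralD//; last 3 first.
- by move=> w _; exact: excursion_hold_ge0.
- exact: excursion_hold_measurable.
- by apply/(measurable_restrictT _ mB).1; exact: measurable_cst.
rewrite -integral_mkcond integral_cst//.
rewrite (_ : (+oo * _ = 0)%E) ?adde0; last first.
  by transitivity (+oo * P B)%E => //; rewrite B0 mule0.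
exact: le_lt_trans (excursion_hold_integral _ HC) (ltry _).
Qed.

End Construction.

(** Foster's criterion. For the chain killed on entering [x], the Lyapunov
    inequality bounds the expected total of the mean holding times and makes the
    survival probability vanish; the former bounds the expected return time once
    the latter has made the return almost sure. *)
Theorem foster_positive_recurrent (V : S -> R) :
  lyapunov q V -> positive_recurrent q.
Proof.
move=> /(lyapunov_jump_chain q nb lf exit_gt0)[W [F [eps [b [W0 eps0 b0 Wc Wd]]]]].
move=> x d T P Y H mc; right.
have p0 := jump_prob_ge0 q nb lf exit_gt0.
have p1 := avoid_prob_le1 q nb lf exit_gt0 x.
have dies := avoid_dies q nb lf exit_gt0 comm x.
have r0 y : 0 <= (exit_rate q y)^-1 by rewrite invr_ge0 ltW.
have Wd' y : transfer (jump_prob q) (avoid nb x) W y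
    <= W y - eps * (exit_rate q y)^-1 + b * charac F y.
  by apply: le_trans (Wd y); exact: (avoid_le q nb lf exit_gt0).
have [C HC] := drift_bounds _ _ p0 p1 dies _ _ _ _ _ W0 r0 eps0 b0 Wd' x.
apply: (return_time_integral _ _ _ _ mc C) => [n|eta eta0].
  by have [] := HC n.
exact: (survival_cvg0 _ _ p0 p1 dies _ _ _ _ _ W0 r0 eps0 b0 Wd' Wc).
Qed.

End Foster.

(** * Means under truncated geometric laws *)

(** The strict inequality is what leaves room for a uniform gap [delta]. *)
Lemma limn_esup_lt {R : realType} (a : nat -> R) (m : R) :
  (limn_esup (fun n => (a n)%:E) < m%:E)%E <->
  exists2 delta, 0 < delta &
    exists N, forall n, (N <= n)%N -> a n <= m - delta.
Proof.
rewrite /limn_esup limf_esupE; split.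
  move=> /ereal_inf_lt[_ [A [N _ NA] <-]] Am.
  have aA n : (N <= n)%N -> ((a n)%:E <= ereal_sup [set (a n)%:E | n in A])%E.
    by move=> Nn; apply: ereal_sup_ubound; exists n => //; exact: NA.
  case: (ereal_sup _) Am aA => [l|//|_ /(_ N (leqnn _))//].
  rewrite lte_fin => lm aA; exists (m - l); first by rewrite subr_gt0.
  by exists N => n /aA; rewrite lee_fin opprB addrCA subrr addr0.
move=> [delta d0 [N aN]]; apply: (@le_lt_trans _ _ (m - delta)%:E); last first.
  by rewrite lte_fin ltrBlDr ltrDl.
apply: le_trans (ereal_inf_lbound _) _.
  by exists [set n | (N <= n)%N] => //; exists N.
by apply: ge_ereal_sup => _ [n /= Nn <-]; rewrite lee_fin aN.
Qed.

Definition geom_mean {R : realType} (lam : nat -> R) (z : R) (n : nat) : R :=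
  (\sum_(j < n.+1) lam j * z ^+ j) / \sum_(i < n.+1) z ^+ i.

(** The law charges only the points up to [n], so [lam] may be replaced by the
    finite combination of indicators that agrees with it there. *)
Lemma expectation_geom {R : realType} (lam : nat -> R) (z : R)
    {d : measure_display} {T : measurableType d} (P : probability T R)
    (Z : {RV P >-> nat}) (n : nat) :
  (forall k, 0 <= lam k) -> geom_law n z Z ->
  ('E_P[fun w => lam (Z w)] = (geom_mean lam z n)%:E)%E.
Proof.
move=> lam0 HZ; rewrite unlock.
have mf (f : nat -> \bar R) : measurable_fun [set: nat] f by [].
transitivity (\int[distribution P Z]_y (lam y)%:E)%E.
  by rewrite (ge0_integral_distribution Z (mf _))// => y; rewrite lee_fin.
pose g (j y : nat) : \bar R := ((lam j)%:E * (\1_[set j] y)%:E)%E.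
have g0 j y : (0 <= g j y)%E by rewrite mule_ge0// lee_fin// indicE ler0n.
transitivity (\int[distribution P Z]_y \sum_(0 <= j < n.+1) g j y)%E.
  apply: ge0_ae_eq_integral => //.
  - by move=> y _; rewrite lee_fin.
  - by move=> y _; exact: sume_ge0.
  have null j : (distribution P Z).-negligible
      (if (n < j)%N then [set j] else set0).
    case: ifPn => [nj|_]; last exact: negligible_set0.
    apply/negligibleP => //; apply: etrans (HZ j) _; by rewrite leqNgt nj.
  apply: negligibleS (negligible_bigcup null).
  move=> y /= /not_implyP[_ yn]; exists y => //; case: ifPn => //.
  rewrite -leqNgt => ylen; exfalso.
  apply: yn; rewrite big_mkord (bigD1 (inord y))//= inordK//.
  rewrite /g indicE mem_set// mule1 big1 ?adde0// => i iy.
  rewrite indicE memNset ?mule0// => /= yi.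
  by move: iy; rewrite yi inord_val eqxx.
rewrite ge0_integral_sum//.
rewrite /geom_mean mulr_suml -sumEFin big_mkord; apply: eq_bigr => j _.
rewrite /g ge0_integralZl_EFin//.
rewrite integral_indic// setIT.
transitivity ((lam j)%:E * distribution P Z [set (j : nat)])%E; first by [].
by rewrite HZ -ltnS ltn_ord -EFinM mulrA.
Qed.

(** * Drift in the tandem system *)

Section System.
Context {R : realType} (lam : nat -> R) (mu1 mu2 : R).
Hypothesis lam_ge0 : forall k, 0 <= lam k.
Hypothesis mu1_gt0 : 0 < mu1.
Hypothesis mu2_gt0 : 0 < mu2.
Let q := system_rate lam mu1 mu2.

Definition system_nb (x : nat * nat) : seq (nat * nat) :=
  (x.1.+1, x.2) ::
    (if x.1 is a.+1 then [:: (a, x.2.+1)] else [::]) ++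
    (if x.2 is b.+1 then [:: (x.1, b)] else [::]).

Lemma rate_arrival a b : q (a, b) (a.+1, b) = lam b.
Proof. by rewrite /q /system_rate eqxx. Qed.

Lemma rate_transfer a b : q (a.+1, b) (a, b.+1) = mu1.
Proof.
rewrite /q /system_rate /= eqxx ifF//.
by apply/negP => /eqP[]; lia.
Qed.

Lemma rate_departure a b : q (a, b.+1) (a, b) = mu2.
Proof.
rewrite /q /system_rate /= eqxx !ifF//; first by apply/negP => /andP[_ /eqP[]]; lia.
by apply/negP => /eqP[]; lia.
Qed.

Lemma system_locally_finite : locally_finite q system_nb.
Proof.
split.
- move=> x y; rewrite /q /system_rate; case: ifP => // _.
  by case: ifP => _; [exact: ltW | case: ifP => // _; exact: ltW].
- move=> [[|a] [|b]]; rewrite /system_nb /= ?inE ?xpair_eqE/=; lia.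
- move=> [[|a] [|b]]; rewrite /system_nb /= ?inE ?xpair_eqE/=; lia.
- move=> [[|a] [|b]] [c e] _; rewrite /system_nb /q /system_rate /= !inE ?negb_or.
  + by move=> /negPf ->.
  + by move=> /andP[/negPf -> /negPf ->].
  + by move=> /andP[/negPf -> /negPf ->].
  + by move=> /and3P[/negPf -> /negPf -> /negPf ->].
Qed.

Let lf := system_locally_finite.

Lemma system_exit_gt0 : 0 < lam 0%N -> forall x, 0 < exit_rate q x.
Proof.
move=> lam0 [[|a] [|b]]; rewrite (exit_rateE _ _ lf) /system_nb /=
  ?(big_cons, big_nil) ?rate_arrival ?rate_transfer ?rate_departure ?addr0//.
- by rewrite ltr_wpDl.
- by rewrite ltr_wpDl.
- by rewrite ltr_wpDl// addr_gt0.
Qed.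

Definition reach (x y : nat * nat) : Prop :=
  exists2 s, path (fun a b => (b \in system_nb a) && (0 < q a b)) x s
    & last x s = y.

Lemma reach_refl x : reach x x. Proof. by exists [::]. Qed.

Lemma reach_trans {y x z} : reach x y -> reach y z -> reach x z.
Proof.
move=> [s ps ls] [t pt lt]; exists (s ++ t); first by rewrite cat_path ps ls.
by rewrite last_cat ls.
Qed.

Lemma reach_step x y : y \in system_nb x -> 0 < q x y -> reach x y.
Proof. by move=> xy qxy; exists [:: y] => //=; rewrite xy qxy. Qed.

Lemma reach_transfer a b : reach (a.+1, b) (a, b.+1).
Proof.
apply: reach_step; first by rewrite /system_nb !inE eqxx orbT.
by rewrite rate_transfer.
Qed.

Lemma reach_departure a b : reach (a, b.+1) (a, b).
Proof.
apply: reach_step; last by rewrite rate_departure.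
by rewrite /system_nb inE mem_cat inE eqxx !orbT.
Qed.

(** Every state drains to the empty system by transfers and departures alone;
    from there [a + b] arrivals at the first queue, possible because
    [lam 0 > 0], followed by [b] transfers lead to the state [(a, b)]. *)
Lemma system_communicating : 0 < lam 0%N -> communicating q system_nb.
Proof.
move=> lam0 x y.
have drain a b : reach (a, b) (0, 0)%N.
  elim: a b => [|a IHa]; elim=> [|b IHb]; first exact: reach_refl.
  - exact: reach_trans (reach_departure _ _) IHb.
  - exact: reach_trans (reach_transfer _ _) (IHa _).
  - exact: reach_trans (reach_departure _ _) IHb.
have fill n : reach (0, 0)%N (n, 0)%N.
  elim: n => [|n IH]; first exact: reach_refl.
  apply: reach_trans IH _; apply: reach_step; last by rewrite rate_arrival.
  by rewrite /system_nb inE eqxx.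
have shift a b : reach (a + b, 0)%N (a, b).
  elim: b a => [|b IH] a; first by rewrite addn0; exact: reach_refl.
  by rewrite addnS -addSn; exact: reach_trans (IH _) (reach_transfer _ _).
case: x y => [a b] [c e].
exact: reach_trans (reach_trans (drain a b) (fill _)) (shift c e).
Qed.

Let z := mu1 / mu2.
Let z_gt0 : 0 < z. Proof. by rewrite divr_gt0. Qed.

(** The increment of [V_fun] in the second coordinate. *)
Definition slope (r : R) (n : nat) : R :=
  \sum_(0 <= k < n.+1) (1 - (lam k + r) / mu1) * (mu1 / mu2) ^ (k%:Z - n%:Z).

Lemma V_funS1 r a b : V_fun lam mu1 mu2 r (a.+1, b) - V_fun lam mu1 mu2 r (a, b) = 1.
Proof. rewrite /V_fun /= -natr1; ring. Qed.

Lemma V_funS2 r a b :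
  V_fun lam mu1 mu2 r (a, b.+1) - V_fun lam mu1 mu2 r (a, b) = slope r b.
Proof. rewrite /V_fun /= big_nat_recr//= -/(slope r b); ring. Qed.

Lemma slopeE r n : slope r n =
  (\sum_(k < n.+1) (1 - (lam k + r) / mu1) * z ^+ k) / z ^+ n.
Proof.
rewrite /slope big_mkord mulr_suml; apply: eq_bigr => k _.
rewrite -/z expfzDr ?gt_eqF// exprnN -!exprnP; ring.
Qed.

Lemma slope0 r : mu1 * slope r 0 = mu1 - lam 0%N - r.
Proof. by rewrite slopeE big_ord1 !expr0; field; rewrite gt_eqF. Qed.

(** This recursion is the reason for the form of [V_fun]: the slopes solve the
    equation that makes the drift constant wherever the first queue is
    nonempty. *)
Lemma slopeS r n : mu1 * slope r n.+1 = mu1 - lam n.+1 - r + mu2 * slope r n.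
Proof.
have h k : z ^+ k != 0 by rewrite expf_neq0// gt_eqF.
rewrite !slopeE big_ord_recr/=; set s := \sum_(i < n.+1) _.
have mz : mu1 = mu2 * z by rewrite /z mulrCA divff ?mulr1// gt_eqF.
rewrite mulrDl mulfK// mulrDr exprS.
have -> : mu1 * (s / (z * z ^+ n)) = mu2 * (s / z ^+ n).
  rewrite {1}mz; field; rewrite h gt_eqF//.
by move: (s / z ^+ n) => t; field; rewrite gt_eqF.
Qed.

Lemma drift_interior r a b :
  drift q (V_fun lam mu1 mu2 r) (a.+1, b) = (- r)%:E.
Proof.
rewrite (driftE _ _ lf) /system_nb /= big_cons rate_arrival V_funS1 mul1r.
have tr : V_fun lam mu1 mu2 r (a, b.+1) - V_fun lam mu1 mu2 r (a.+1, b)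
    = slope r b - 1.
  by rewrite -(V_funS2 r a b) -(V_funS1 r a b); ring.
congr (_%:E); case: b tr => [|b] tr; rewrite ?(big_cons, big_nil) rate_transfer tr.
  have := slope0 r; lra.
rewrite rate_departure -[X in _ + (_ + (X * _ + _))]opprB V_funS2.
have := slopeS r b; lra.
Qed.

(** With an empty first queue the transfer term is missing, which adds
    [mu1 * (1 - slope r b)] to the constant drift [- r]. *)
Lemma drift_boundary r b :
  drift q (V_fun lam mu1 mu2 r) (0%N, b) = (mu1 - r - mu1 * slope r b)%:E.
Proof.
rewrite (driftE _ _ lf) /system_nb /= big_cons rate_arrival V_funS1 mul1r.
congr (_%:E); case: b => [|b]; rewrite ?(big_cons, big_nil).
  have := slope0 r; lra.
rewrite rate_departure -[X in _ + (X * _ + _)]opprB V_funS2.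
have := slopeS r b; lra.
Qed.

(** Only finitely many of the states [(0, n)] are exceptional, so a negative drift
    holds at all those with [n] large. *)
Lemma lyapunov_slope r : 0 < r ->
  lyapunov q (V_fun lam mu1 mu2 r) ->
  exists2 e, 0 < e & exists N, forall n, (N <= n)%N ->
    mu1 - r + e <= mu1 * slope r n.
Proof.
move=> r0 [_ _ [S0 /finite_seqP[s ->] /ereal_sup_lt0[e e0 He]]].
exists e => //; exists (\sum_(x <- s) x.2).+1 => n sn.
have := He (drift q (V_fun lam mu1 mu2 r) (0%N, n)).
rewrite drift_boundary lee_fin => h.
have : mu1 - r - mu1 * slope r n <= - e; last by lra.
apply: h; exists (0%N, n); last by rewrite drift_boundary.
move=> /= ns; move: sn; rewrite (big_rem _ ns)/=; lia.
Qed.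

(** Eventual slopes of at least [1] give both coercivity, as [V_fun] then grows at
    least like the total number of customers, and drift at most [- r] outside
    finitely many states of the boundary. *)
Lemma slope_lyapunov r N : 0 < r ->
  (forall n, (N <= n)%N -> 1 <= slope r n) ->
  lyapunov q (V_fun lam mu1 mu2 r).
Proof.
move=> r0 HN; split.
- move=> x; rewrite (esum_neighbours _ _ lf (fun y => _ * q x y)) ?ltry//.
    by move=> y; rewrite mulr_ge0// (lf_ge0 _ _ lf).
  by move=> y yx ynb; rewrite (lf_supp _ _ lf) ?mulr0.
- pose C := \sum_(0 <= j < N) `|slope r j - 1|.
  have low a b : (a + b)%:R - C <= V_fun lam mu1 mu2 r (a, b).
    have W0 : V_fun lam mu1 mu2 r (a, 0%N) = a%:R.
      by rewrite /V_fun /= big_geq// addr0.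
    have part n : (a + n)%:R - \sum_(0 <= j < n) `|slope r j - 1|
        <= V_fun lam mu1 mu2 r (a, n).
      elim: n => [|n IH]; first by rewrite W0 big_geq// subr0 addn0.
      have := V_funS2 r a n; rewrite big_nat_recr//= addnS -natr1.
      have := ler_norm (- (slope r n - 1)); rewrite normrN; move: IH; lra.
    have [bN|Nb] := leqP b N.
      apply: le_trans (part b); rewrite lerB// /C (big_cat_nat (leq0n b) bN)//= lerDl.
      exact: sumr_ge0.
    rewrite -(subnKC (ltnW Nb)); elim: (b - N)%N => [|k IH].
      by rewrite addn0; exact: part.
    have := V_funS2 r a (N + k); have := HN (N + k)%N (leq_addr _ _).
    rewrite !addnS -natr1; move: IH; lra.
  move=> M; pose B := Num.bound (`|M| + C).
  have C0 : 0 <= C by exact: sumr_ge0.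
  apply: sub_finite_set (finite_setX (finite_II B) (finite_II B)).
  move=> [a b] /= VM.
  have : (a + b)%:R < B%:R :> R.
    apply: le_lt_trans (archi_boundP (addr_ge0 (normr_ge0 M) C0)).
    have := low a b; have := ler_norm M; move: VM; lra.
  rewrite ltr_nat /mkset; lia.
- exists [set x | x.1 = 0%N /\ (x.2 < N)%N].
    apply: sub_finite_set (finite_setX (finite_II 1) (finite_II N)).
    by move=> [a b] /= [-> bN].
  apply: (@le_lt_trans _ _ (- r)%:E); last by rewrite lte_fin oppr_lt0.
  apply: ge_ereal_sup => _ [[[|a] b] /= H <-]; last by rewrite drift_interior.
  rewrite drift_boundary lee_fin.
  have /HN : (N <= b)%N by rewrite leqNgt; apply/negP => bN; exact: H.
  by rewrite -(ler_pM2l mu1_gt0) mulr1; lra.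
Qed.

End System.

(** * Slopes and means of the arrival rate *)

Section Slope.
Context {R : realType} (lam : nat -> R) (mu1 mu2 : R).
Hypothesis mu1_gt0 : 0 < mu1.
Hypothesis mu2_gt0 : 0 < mu2.
Let z := mu1 / mu2.
Let z_gt0 : 0 < z. Proof. by rewrite divr_gt0. Qed.
Let a := geom_mean lam z.

Definition geom_weight (n : nat) : R := (\sum_(i < n.+1) z ^+ i) / z ^+ n.

(** The link between the two sides of the theorem: up to the explicit factor
    [geom_weight n], the slope is the gap between [mu1 - r] and the mean of [lam]
    under the truncated geometric law. *)
Lemma slope_geom_mean r n :
  mu1 * slope lam mu1 mu2 r n = geom_weight n * (mu1 - a n - r).
Proof.
rewrite slopeE// -/z /geom_weight /a /geom_mean.
under eq_bigr do rewrite mulrBl mul1r mulrAC mulrDl mulrDl.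
rewrite sumrB big_split/= -!mulr_suml -mulr_sumr.
set G := \sum_(i < n.+1) z ^+ i; set L := \sum_(j < n.+1) _.
have G0 : G != 0.
  rewrite gt_eqF// /G big_ord_recl expr0 ltr_wpDr// sumr_ge0// => i _.
  by rewrite exprn_ge0// ltW.
have zn : z ^+ n != 0 by rewrite expf_neq0// gt_eqF.
by field; rewrite zn G0 gt_eqF.
Qed.

(** When [mu2 < mu1] the weights converge to [mu1 / (mu1 - mu2)]; the identity
    says so with the exact error. *)
Lemma geom_weight_eq n : geom_weight n * (mu1 - mu2) = mu1 - mu2 * z^-1 ^+ n.
Proof.
have zn : z ^+ n != 0 by rewrite expf_neq0// gt_eqF.
have mz : mu1 = mu2 * z by rewrite /z mulrCA divff ?mulr1// gt_eqF.
rewrite /geom_weight exprVn; set G := \sum_(i < n.+1) _.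
have hG : G * (z - 1) = z * z ^+ n - 1 by rewrite mulrC -subrX1 exprS.
rewrite mz; transitivity (mu2 * (G * (z - 1)) / z ^+ n); first by field.
by rewrite hG; field.
Qed.

Lemma geom_weight_ge1 n : 1 <= geom_weight n.
Proof.
rewrite /geom_weight ler_pdivlMr ?exprn_gt0// mul1r big_ord_recr/= lerDr.
by rewrite sumr_ge0// => i _; rewrite exprn_ge0// ltW.
Qed.

Lemma geom_weight_ge n : mu1 <= mu2 -> n.+1%:R <= geom_weight n.
Proof.
move=> m12; have z1 : z <= 1 by rewrite ler_pdivrMr// mul1r.
rewrite /geom_weight ler_pdivlMr ?exprn_gt0//.
rewrite -[X in X%:R](card_ord n.+1) -sumr_const mulr_suml; apply: ler_sum => i _.
by rewrite mul1r ler_wiXn2l// ?ltW// -ltnS.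
Qed.

(** Half of the gap is spent on [r]. If [mu1 <= mu2] the other half is multiplied
    by weights that tend to infinity; if [mu2 < mu1] the limit of the weights
    turns [mu1 - mu2] into [mu1], and the other half absorbs the error term. *)
Lemma slope_eventually_ge1 delta N : 0 < delta ->
  (forall n, (N <= n)%N -> a n <= Num.min mu1 mu2 - 2 * delta) ->
  exists N', forall n, (N' <= n)%N -> 1 <= slope lam mu1 mu2 delta n.
Proof.
move=> d0 aN.
have below n : (N <= n)%N -> geom_weight n * (mu1 - Num.min mu1 mu2 + delta)
    <= mu1 * slope lam mu1 mu2 delta n.
  move=> Nn; rewrite slope_geom_mean; apply: ler_wpM2l.
    exact: le_trans ler01 (geom_weight_ge1 n).
  have := aN n Nn; lra.
suff [N1 HN1] : exists N1, forall n, (N1 <= n)%N ->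
    mu1 <= geom_weight n * (mu1 - Num.min mu1 mu2 + delta).
  exists (maxn N N1) => n; rewrite geq_max => /andP[Nn N1n].
  rewrite -(ler_pM2l mu1_gt0) mulr1; exact: le_trans (HN1 n N1n) (below n Nn).
have [m12|m21] := leP mu1 mu2.
  exists (Num.bound (mu1 / delta)) => n Nn; rewrite subrr add0r.
  have := archi_boundP (divr_ge0 (ltW mu1_gt0) (ltW d0)).
  rewrite ltr_pdivrMr// => /ltW/le_trans; apply; rewrite ler_pM2r//.
  apply: le_trans (geom_weight_ge n m12); rewrite ler_nat; exact: leqW.
have y1 : `|z^-1| < 1.
  by rewrite ger0_norm ?invr_ge0 ?ltW// invf_lt1 /z ?divr_gt0// ltr_pdivlMr// mul1r.
have e0 : 0 < delta / mu2 by rewrite divr_gt0.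
have /cvgrPdist_lt/(_ _ e0)[N1 _ HN1] := cvg_expr y1.
exists N1 => n /HN1; rewrite /= sub0r normrN => hn.
rewrite mulrDr geom_weight_eq.
have : mu2 * z^-1 ^+ n <= delta.
  rewrite mulrC -ler_pdivlMr//; exact: le_trans (ler_norm _) (ltW hn).
have : delta <= geom_weight n * delta by rewrite ler_peMl ?geom_weight_ge1// ltW.
lra.
Qed.

(** If [mu1 <= mu2] the gap comes from [r] alone, since the weights are at least
    [2]; if [mu2 < mu1] it comes from [e], divided by the upper bound
    [mu1 / (mu1 - mu2)] of the weights. *)
Lemma geom_mean_eventually_le r e N : 0 < r -> 0 < e ->
  (forall n, (N <= n)%N -> mu1 - r + e <= mu1 * slope lam mu1 mu2 r n) ->
  exists2 delta, 0 < delta & exists N', forall n, (N' <= n)%N ->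
    a n <= Num.min mu1 mu2 - delta.
Proof.
move=> r0 e0 HN; have [m12|m21] := leP mu1 mu2.
  exists (r / 2); first by rewrite divr_gt0.
  exists (maxn N 1) => n; rewrite geq_max => /andP[/HN + n1].
  rewrite slope_geom_mean => h.
  have g2 : 2 <= geom_weight n.
    by apply: le_trans (geom_weight_ge n m12); rewrite ler_nat.
  have g0 : 0 < geom_weight n by apply: lt_le_trans g2.
  rewrite leNgt; apply/negP => an.
  have : geom_weight n * (mu1 - a n - r) <= geom_weight n * (- (r / 2)).
    rewrite ler_pM2l//; lra.
  have : r <= geom_weight n * (r / 2).
    apply: (@le_trans _ _ (2 * (r / 2))); last by rewrite ler_pM2r// divr_gt0.
    lra.
  rewrite mulrN => rY XY.
  have : mu1 - r + e <= - r by apply: le_trans h (le_trans XY _); rewrite lerN2.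
  have := mu1_gt0; lra.
have D0 : 0 < mu1 - mu2 by rewrite subr_gt0.
exists (e * (mu1 - mu2) / mu1); first by rewrite !mulr_gt0// invr_gt0.
exists N => n /HN; rewrite slope_geom_mean => h.
have g1 := geom_weight_ge1 n; have g0 : 0 < geom_weight n := lt_le_trans ltr01 g1.
have gD : geom_weight n * (mu1 - mu2) <= mu1.
  by rewrite geom_weight_eq gerBl mulr_ge0 ?exprn_ge0 ?invr_ge0 ?ltW.
rewrite -(ler_pM2l g0).
have : geom_weight n * (e * (mu1 - mu2) / mu1) <= e.
  have -> : geom_weight n * (e * (mu1 - mu2) / mu1)
            = e * (geom_weight n * (mu1 - mu2) / mu1) by ring.
  by rewrite ler_piMr ?(ltW e0)// ler_pdivrMr// mul1r.
have : r <= geom_weight n * r by rewrite ler_peMl// ltW.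
move: h gD; rewrite !mulrBr; lra.
Qed.

End Slope.

(** * Lyapunov functions and stability *)

Theorem theorem2 (R : realType) (lam : nat -> R) (mu1 mu2 : R)
    (lam_ge0 : forall k, 0 <= lam k) (mu1_gt0 : 0 < mu1) (mu2_gt0 : 0 < mu2)
    (d : nat -> measure_display) (T : forall n, measurableType (d n))
    (P : forall n, probability (T n) R) (Z : forall n, {RV (P n) >-> nat})
    (Z_geom : forall n, geom_law n (mu1 / mu2) (Z n)) :
  let star :=
    (limn_esup (fun n => 'E_(P n)[fun w => lam (Z n w)])
       < (Num.min mu1 mu2)%:E)%E in
  ((exists r : R, 0 < r /\
      lyapunov (system_rate lam mu1 mu2) (V_fun lam mu1 mu2 r)) <-> star) /\
  (0 < lam 0%N -> star -> stable lam mu1 mu2).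
Proof.
set star := (_ < _)%E => /=.
have starE : star <-> exists2 delta, 0 < delta & exists N, forall n, (N <= n)%N ->
    geom_mean lam (mu1 / mu2) n <= Num.min mu1 mu2 - delta.
  rewrite -limn_esup_lt /star.
  by under eq_fun => n do rewrite (expectation_geom _ _ _ _ _ lam_ge0 (Z_geom n)).
have star_lyapunov : star -> exists r : R, 0 < r /\
    lyapunov (system_rate lam mu1 mu2) (V_fun lam mu1 mu2 r).
  move=> /starE[delta d0 [N HN]].
  have d2 : 0 < delta / 2 by rewrite divr_gt0.
  have [|N' HN'] := slope_eventually_ge1 lam mu1 mu2 mu1_gt0 mu2_gt0 (delta / 2) N d2.
    by move=> n /HN; rewrite mulrCA divff// mulr1.
  exists (delta / 2); split => //.
  exact: (slope_lyapunov _ _ _ lam_ge0 mu1_gt0 mu2_gt0 _ N').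
split; first split => //.
  move=> [r [r0 /(lyapunov_slope _ _ _ lam_ge0 mu1_gt0 mu2_gt0 r r0)[e e0 [N HN]]]].
  by apply/starE; exact: (geom_mean_eventually_le _ _ _ _ _ _ _ N r0 e0).
move=> lam0 /star_lyapunov[r [r0 lyap]].
have lf := system_locally_finite lam mu1 mu2 lam_ge0 mu1_gt0 mu2_gt0.
have ex := system_exit_gt0 lam mu1 mu2 lam_ge0 mu1_gt0 mu2_gt0 lam0.
have comm := system_communicating lam mu1 mu2 mu1_gt0 mu2_gt0 lam0.
split; first exact: communicating_irreducible lf ex comm.
exact: foster_positive_recurrent lf ex comm _ lyap.
Qed.
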